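(* Let $I\subseteq\mathbb{R}$ be a nonempty interval and let $f:I\to\mathbb{R}$ be operator convex. For every $\lambda\in(0,1)$, $\alpha\in[0,1]$ and all $A,B\in\mathcal{S}_I(H)$, $$f\big(A\nabla_{r(\lambda,\alpha)}B\big)\le\int_0^1 f\big(A\nabla_{r(\lambda,t)}B\big)\,d\eta_\alpha(t)\le f\big(A\nabla_\lambda B\big)\nabla_\alpha f\big(A\nabla_{1-\lambda}B\big)\le\mathcal{M}_{\lambda,\alpha}(f;A,B)\le f(A)\nabla_{r(\lambda,\alpha)}f(B).$$ If $f$ is operator concave, all the inequalities are reversed.
   Context: $H$ is a complex Hilbert space, $\mathcal{B}(H)$ the bounded linear operators on $H$. For self-adjoint operators, $A\le B$ means that $B-A$ is positive. $\mathcal{S}_I(H)$ is the set of self-adjoint operators in $\mathcal{B}(H)$ with spectrum contained in $I$; for $f:I\to\mathbb{R}$ (continuous) and $A\in\mathcal{S}_I(H)$, $f(A)$ is defined by the continuous functional calculus. $f$ is operator convex (resp. concave) on $I$ if $f((1-\lambda)A+\lambda B)\le$ (resp. $\ge$) $(1-\lambda)f(A)+\lambda f(B)$ for all $A,B\in\mathcal{S}_I(H)$, $\lambda\in[0,1]$. For $X,Y\in\mathcal{B}(H)$ and $\lambda\in[0,1]$, $X\nabla_\lambda Y:=(1-\lambda)X+\lambda Y$. For $\lambda\in(0,1)$, $\eta_\lambda$ is the probability measure on $[0,1]$ given by $d\eta_\lambda(t)=\frac{\lambda}{1-\lambda}\,t^{\frac{2\lambda-1}{1-\lambda}}\,dt$;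 at the endpoints $\eta_0$ and $\eta_1$ are understood as the weak limits of $\eta_\lambda$ as $\lambda\to0$ and $\lambda\to1$, i.e. the Dirac measures at $0$ and at $1$. For $\nu,\alpha\in[0,1]$, $r(\nu,\alpha):=\nu+\alpha-2\nu\alpha$. For $\lambda\in(0,1)$, $\alpha\in[0,1]$, $\sigma_{\lambda,\alpha}:=(1-\alpha)\eta_\lambda+\alpha\,\eta_{1-\lambda}$ and $\mathcal{M}_{\lambda,\alpha}(f;A,B):=\int_0^1 f(A\nabla_t B)\,d\sigma_{\lambda,\alpha}(t)$. Integrals of operator-valued functions are norm integrals. *)

(* Defs.v *)
From HB Require Import structures.
From mathcomp Require Import all_boot all_order all_algebra.
From mathcomp Require Import sesquilinear complex.
From mathcomp Require Import all_classical all_reals all_analysis.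
From mathcomp Require Import measurable_realfun.

Set Implicit Arguments.
Unset Strict Implicit.
Unset Printing Implicit Defensive.

Import Order.TTheory GRing.Theory Num.Theory.
Import numFieldNormedType.Exports.

Local Open Scope classical_set_scope.
Local Open Scope complex_scope.
Local Open Scope ring_scope.

HB.mixin Record isHilbert (R : realType) H & CompleteNormedModule R[i] H := {
  inner : {dot H for (@Num.conj R[i])} ;
  inner_norm : forall x : H, inner x x = `|x| ^+ 2
}.

#[short(type="hilbertType")]
HB.structure Definition Hilbert (R : realType) :=
  {H of CompleteNormedModule R[i] H & isHilbert R H}.

Section bounded_operators.
Context {R : realType} {H : hilbertType R}.
Implicit Types (T : H -> H).

Definition bounded_linear_pred : {pred H -> H} := fun T =>
  `[< linear T /\ exists M : R[i], forall x, `|T x| <= M * `|x| >].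

Structure bop := Bop {
  bop_fun :> H -> H ;
  _ : bop_fun \in bounded_linear_pred }.

HB.instance Definition _ := [isSub for bop_fun].
HB.instance Definition _ := [Choice of bop by <:].

Lemma bounded_linearP T : reflect
  (linear T /\ exists M : R[i], forall x, `|T x| <= M * `|x|)
  (T \in bounded_linear_pred).
Proof. exact: asboolP. Qed.

Lemma bop_submod : submod_closed bounded_linear_pred.
Proof.
split.
  apply/bounded_linearP; split=> [a x y /=|].
    by change (0 = a *: 0 + 0 :> H); rewrite scaler0 addr0.
  by exists 0 => x; rewrite mul0r [_ x]/(0 : H) normr0.
move=> a S T /bounded_linearP[lS [M hM]] /bounded_linearP[lT [N hN]].
apply/bounded_linearP; split=> [b x y|].
  rewrite !fctE lS lT !scalerDr !scalerA addrACA; congr (_ + _ + _).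
  by rewrite mulrC.
exists (`|a| * M + N) => x; rewrite !fctE.
rewrite (le_trans (ler_normD _ _))// mulrDl lerD//.
by rewrite normrZ -mulrA ler_wpM2l.
Qed.

HB.instance Definition _ :=
  GRing.isSubmodClosed.Build R[i] (H -> H) bounded_linear_pred bop_submod.
HB.instance Definition _ := [SubChoice_isSubLmodule of bop by <:].

Implicit Types A B C : bop.

Lemma bop_linear A : linear A.
Proof. by have /bounded_linearP[] := valP A. Qed.

HB.instance Definition _ A :=
  GRing.isLinear.Build R[i] H H *:%R (bop_fun A) (@bop_linear A).

Lemma bop_bounded A : exists M : R[i], forall x, `|A x| <= M * `|x|.
Proof. by have /bounded_linearP[] := valP A. Qed.

Lemma bopP A B : A =1 B -> A = B.
Proof. by move=> AB; apply: val_inj; apply/funext. Qed.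

Lemma bopDE A B x : (A + B) x = A x + B x. Proof. by []. Qed.
Lemma bopNE A x : (- A) x = - A x. Proof. by []. Qed.
Lemma bopZE a A x : (a *: A) x = a *: A x. Proof. by []. Qed.
Lemma bop0E x : (0 : bop) x = 0. Proof. by []. Qed.

Lemma bop_id_subproof : (idfun : H -> H) \in bounded_linear_pred.
Proof.
by apply/bounded_linearP; split=> //; exists 1 => x; rewrite mul1r.
Qed.
Definition bop_id : bop := Bop bop_id_subproof.

Lemma bop_comp_subproof A B : A \o B \in bounded_linear_pred.
Proof.
apply/bounded_linearP; split=> [a x y /=|]; first by rewrite !linearP.
have [M hM] := bop_bounded A; have [N hN] := bop_bounded B.
exists (`|M| * N) => x /=; rewrite (le_trans (hM _))//.
have [->|Bx0] := eqVneq (B x) 0.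
  rewrite normr0 mulr0 -mulrA mulr_ge0//.
  by rewrite (le_trans _ (hN x)).
have M0 : 0 <= M.
  by rewrite -(pmulr_lge0 M (_ : 0 < `|B x|)) ?normr_gt0// (le_trans _ (hM _)).
by rewrite ger0_norm// -mulrA ler_wpM2l.
Qed.
Definition bop_comp A B : bop := Bop (bop_comp_subproof A B).

Lemma bop_compA : associative bop_comp. Proof. by move=> A B C; exact: bopP. Qed.
Lemma bop_comp1l : left_id bop_id bop_comp. Proof. by move=> A; exact: bopP. Qed.
Lemma bop_comp1r : right_id bop_id bop_comp. Proof. by move=> A; exact: bopP. Qed.
Lemma bop_compDl : left_distributive bop_comp +%R.
Proof. by move=> A B C; exact: bopP. Qed.
Lemma bop_compDr : right_distributive bop_comp +%R.
Proof. by move=> A B C; apply: bopP => x /=; rewrite linearD. Qed.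

HB.instance Definition _ := GRing.Zmodule_isPzRing.Build bop
  bop_compA bop_comp1l bop_comp1r bop_compDl bop_compDr.

(* norms over R[i] take real nonnegative values in R[i], hence the real parts *)
Definition opnorm A : R := sup [set complex.Re `|A x| | x in [set x | `|x| <= 1]].

Lemma norm_Re (x : H) : (complex.Re `|x|)%:C = `|x|.
Proof. by rewrite RRe_real// ger0_real. Qed.

Lemma opnorm_has_sup A :
  has_sup [set complex.Re `|A x| | x in [set x | `|x| <= 1]].
Proof.
split; first by exists (complex.Re `|A 0|), 0 => //=; rewrite normr0.
have [M hM] := bop_bounded A.
exists (complex.Re `|M|) => _ [x x1 <-].
rewrite -lecR norm_Re RRe_real ?ger0_real//.
have [->|x0] := eqVneq x 0; first by rewrite linear0 normr0.
have M0 : 0 <= M.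
  by rewrite -(pmulr_lge0 M (_ : 0 < `|x|)) ?normr_gt0// (le_trans _ (hM _)).
by rewrite ger0_norm// (le_trans (hM x))// ler_piMr.
Qed.

Lemma opnorm_ub A x : `|x| <= 1 -> `|A x| <= (opnorm A)%:C.
Proof.
move=> x1; rewrite -norm_Re lecR.
by apply: ub_le_sup; [have [] := opnorm_has_sup A|exists x].
Qed.

Lemma opnorm_le A (M : R) :
  (forall x, `|x| <= 1 -> `|A x| <= M%:C) -> opnorm A <= M.
Proof.
move=> h; apply: ge_sup; first by have [] := opnorm_has_sup A.
by move=> _ [x /= x1 <-]; rewrite -lecR norm_Re h.
Qed.

Lemma opnorm_ge0 A : 0 <= opnorm A.
Proof.
by rewrite -lecR (le_trans _ (@opnorm_ub A 0 _))// normr0.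
Qed.

Lemma bop_normD A B : (opnorm (A + B))%:C <= (opnorm A)%:C + (opnorm B)%:C.
Proof.
rewrite -rmorphD lecR; apply: opnorm_le => x x1.
by rewrite rmorphD (le_trans (ler_normD _ _))// lerD// opnorm_ub.
Qed.

Lemma bop_normZle a A : (opnorm (a *: A))%:C <= `|a| * (opnorm A)%:C.
Proof.
have -> : `|a| = (complex.Re `|a|)%:C by rewrite RRe_real// ger0_real.
rewrite -rmorphM lecR; apply: opnorm_le => x x1.
rewrite rmorphM bopZE normrZ [X in _ <= X * _]RRe_real ?ger0_real//.
by rewrite ler_wpM2l// opnorm_ub.
Qed.

Lemma bop_normZ a A : (opnorm (a *: A))%:C = `|a| * (opnorm A)%:C.
Proof.
apply/eqP; rewrite eq_le bop_normZle/=.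
have [->|a0] := eqVneq a 0; first by rewrite normr0 mul0r lecR opnorm_ge0.
rewrite -ler_pdivlMl ?normr_gt0// -normfV.
by rewrite (le_trans _ (bop_normZle _ _))// scalerA mulVf// scale1r.
Qed.

Lemma bop_norm0_eq0 A : (opnorm A)%:C = 0 -> A = 0.
Proof.
move=> A0; apply: bopP => x; rewrite bop0E.
have [->|x0] := eqVneq x 0; first by rewrite linear0.
have : `|A (`|x|^-1 *: x)| <= 0.
  rewrite -A0; apply: opnorm_ub.
  by rewrite normrZ normfV normr_id mulVf// normr_eq0.
rewrite linearZ normr_le0 scaler_eq0 invr_eq0 normr_eq0 (negbTE x0)/=.
by move/eqP.
Qed.

HB.instance Definition _ := @Lmodule_isNormed.Build R[i] bop
  (fun A => (opnorm A)%:C) bop_normD bop_normZ bop_norm0_eq0.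

End bounded_operators.
Arguments bop {R} H.
Notation "''B(' H )" := (bop H) (format "''B(' H )") : type_scope.

Section operator_notions.
Context {R : realType} {H : hilbertType R}.
Implicit Types (A B : 'B(H)) (I : set R) (f : R -> R).

Definition self_adjoint A := forall x y : H, inner (A x) y = inner x (A y).

(* the order of R[i] makes [0 <= z] say that z is real and nonnegative *)
Definition positive_op A := forall x : H, 0 <= inner (A x) x.

Definition op_le A B := positive_op (B - A).

Definition spectrum A : set R[i] :=
  [set z | ~ exists B, B * (A - z *: (1 : 'B(H))) = 1 /\
                       (A - z *: (1 : 'B(H))) * B = 1].

Definition self_adjoint_on I : set 'B(H) :=
  [set A | self_adjoint A /\ spectrum A `<=` [set x%:C | x in I]].

Definition op_horner (p : {poly R}) A : 'B(H) :=
  \sum_(i < size p) (p`_i)%:C *: A ^+ i.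

(* f(A) is the norm limit of p_n(A) for any real polynomials p_n that converge
   to f uniformly on the spectrum of A *)
Definition is_cfc f A : set 'B(H) :=
  [set T | exists2 p : nat -> {poly R},
    {uniform [set x : R | spectrum A x%:C],
      (fun n (x : R) => (p n).[x]) @ \oo --> f} &
    op_horner (p n) A @[n --> \oo] --> T].

Definition cfc f A : 'B(H) := xget 0 (is_cfc f A).

Definition nabla (l : R) A B : 'B(H) := (1 - l)%:C *: A + l%:C *: B.

Definition operator_convex I f := forall A B, self_adjoint_on I A ->
  self_adjoint_on I B -> forall l : R, 0 <= l <= 1 ->
  op_le (cfc f (nabla l A B)) (nabla l (cfc f A) (cfc f B)).

Definition operator_concave I f := forall A B, self_adjoint_on I A ->
  self_adjoint_on I B -> forall l : R, 0 <= l <= 1 ->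
  op_le (nabla l (cfc f A) (cfc f B)) (cfc f (nabla l A B)).

End operator_notions.
Arguments operator_convex {R} H I f.
Arguments operator_concave {R} H I f.

Notation "A '<=op' B" := (op_le A B) (at level 70, no associativity).

Section bochner.
Context d (T : measurableType d) (R : realType) (V : normedModType R[i]).
Implicit Types (mu : {measure set T -> \bar R}) (D : set T) (s : seq (set T * V)).

(* s represents the simple function \sum_((E, v) <- s) \1_E *: v on D *)
Definition simple_on mu D s :=
  {in s, forall Ev, [/\ measurable Ev.1, Ev.1 `<=` D & (mu Ev.1 < +oo)%E]}.

Definition simple_val s (t : T) : V := \sum_(Ev <- s) (\1_(Ev.1) t)%:C *: Ev.2.

Definition simple_int mu s : V := \sum_(Ev <- s) (fine (mu Ev.1))%:C *: Ev.2.

Definition is_bochner mu D (F : T -> V) : set V :=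
  [set v | exists s : nat -> seq (set T * V), [/\
    forall n, simple_on mu D (s n),
    {ae mu, forall t, D t -> simple_val (s n) t @[n --> \oo] --> F t},
    (\int[mu]_(t in D) (complex.Re `|F t - simple_val (s n) t|%R)%:E)%E
      @[n --> \oo] --> 0%E &
    simple_int mu (s n) @[n --> \oo] --> v]].

(* 0 if F is not Bochner integrable *)
Definition bochner mu D (F : T -> V) : V := xget 0 (is_bochner mu D F).

End bochner.

Section eta.
Context {R : realType}.

Definition eta_pdf (l t : R) : R :=
  l / (1 - l) * t `^ ((2 * l - 1) / (1 - l)).

(* The weak limits of eta l as l -> 0 and l -> 1 are the Dirac masses at 0 and
   at 1; values of l outside `[0, 1] are irrelevant. *)
Definition eta (l : R) (E : set (measurableTypeR R)) : \bar R :=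
  if l <= 0 then \d_(0 : measurableTypeR R) E
  else if 1 <= l then \d_(1 : measurableTypeR R) E
  else (\int[lebesgue_measure]_(t in E `&` `[0%R, 1%R]) (eta_pdf l t)%:E)%E.

Let eta0 l : eta l set0 = 0%E.
Proof. by rewrite /eta !measure0 set0I integral_set0 !if_same. Qed.

Lemma eta_pdf_ge0 l t : 0 < l -> l < 1 -> 0 <= eta_pdf l t.
Proof.
move=> l0 l1; rewrite /eta_pdf mulr_ge0// ?powR_ge0// divr_ge0// ltW//.
by rewrite subr_gt0.
Qed.

Lemma measurable_eta_pdf l : measurable_fun setT (eta_pdf l).
Proof. by apply: measurable_funM => //; exact: measurable_powR. Qed.

Let eta_ge0 l E : (0 <= eta l E)%E.
Proof.
rewrite /eta; case: (leP l 0) => // l0; case: (leP 1 l) => // l1.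
by apply: integral_ge0 => t _; rewrite lee_fin eta_pdf_ge0.
Qed.

Let eta_sigma_additive l : semi_sigma_additive (eta l).
Proof.
rewrite /eta; case: (leP l 0) => l0; first exact: measure_semi_sigma_additive.
case: (leP 1 l) => l1; first exact: measure_semi_sigma_additive.
move=> F mF tF mUF; apply: cvg_toP.
  apply: ereal_nondecreasing_is_cvgn => m n mn.
  apply: lee_sum_nneg_natr => // k _ _; apply: integral_ge0 => /= x Fkx.
  by rewrite lee_fin eta_pdf_ge0.
rewrite setI_bigcupl ge0_integral_bigcup//=.
- by move=> k; exact: measurableI.
- by apply/measurable_funTS/measurableT_comp => //; exact: measurable_eta_pdf.
- by move=> x _; rewrite lee_fin eta_pdf_ge0.
- exact: trivIset_setIr.
Qed.

HB.instance Definition _ l := isMeasure.Build _ _ _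
  (eta l) (eta0 l) (eta_ge0 l) (@eta_sigma_additive l).

Definition sigma (l : R) (a : {i01 R}) :
    {measure set (measurableTypeR R) -> \bar R} :=
  measure_add (mscale (1 - a%:num)%:nng (eta l))
              (mscale a%:num%:nng (eta (1 - l))).

Definition r_weight (nu a : R) : R := nu + a - 2 * nu * a.

End eta.

Definition Mean {R : realType} {H : hilbertType R} (l : R) (a : {i01 R})
    (f : R -> R) (A B : 'B(H)) : 'B(H) :=
  bochner (sigma l a) `[0, 1] (fun t => cfc f (nabla t A B)).

(* Main.v *)
Require Import Defs.
From mathcomp Require Import all_boot all_order all_algebra.
From mathcomp Require Import sesquilinear complex ring lra.
From mathcomp Require Import all_classical all_reals all_analysis.
From mathcomp Require Import measurable_realfun.

(** Restricted to the segment [t |-> A nabla_t B], an operator convex [f] yields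
    a convex map [F] from [0, 1] to self-adjoint operators.  Every inequality is
    tested on the quadratic form [t |-> <F t x, x>], a real convex function: it
    lies below its chord and above its supporting lines, and integrating these
    affine (or maximum of affine) functions against the probability measures
    [eta] and [sigma], whose means are explicit, gives the four bounds.

    Convexity alone makes [F] bounded and norm-Lipschitz on compact subsets of
    ]0, 1[, because the norm of a self-adjoint operator is its numerical radius;
    hence step functions approximate [F] and the Bochner integrals exist; the
    functional calculus enters only through the self-adjointness of [F t].  That
    the segment stays in the domain of [f] follows because the infimum and the
    supremum of the quadratic form of a self-adjoint operator belong to its
    spectrum, while conversely bounds on the form bound the spectrum
    (Lax-Milgram). *)

Set Implicit Arguments.
Unset Strict Implicit.
Unset Printing Implicit Defensive.

Import Order.TTheory GRing.Theory Num.Theory.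
Import numFieldNormedType.Exports.

Local Open Scope classical_set_scope.
Local Open Scope complex_scope.
Local Open Scope ring_scope.

(** * Real norms and real inner products *)

Section real_norm.
Context {R : realType} {V : normedModType R[i]}.
Implicit Types (u v : V) (c : R).

Definition rnorm v : R := complex.Re `|v|.

Lemma rnormE v : (rnorm v)%:C = `|v|.
Proof. by rewrite /rnorm RRe_real// ger0_real. Qed.

Lemma rnorm_ge0 v : 0 <= rnorm v.
Proof. by rewrite -ler0c rnormE. Qed.

Lemma rnorm0 : rnorm 0 = 0.
Proof. by apply: complexI; rewrite rnormE normr0. Qed.

Lemma rnormN v : rnorm (- v) = rnorm v.
Proof. by rewrite /rnorm normrN. Qed.

Lemma rnorm_distC u v : rnorm (u - v) = rnorm (v - u).
Proof. by rewrite /rnorm distrC. Qed.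

Lemma ler_rnormD u v : rnorm (u + v) <= rnorm u + rnorm v.
Proof. by rewrite -lecR rmorphD/= !rnormE ler_normD. Qed.

Lemma rnormZ (z : R[i]) v : rnorm (z *: v) = complex.Re `|z| * rnorm v.
Proof.
apply: complexI; rewrite rnormE normrZ -(rnormE v).
by rewrite -[in LHS](RRe_real (ger0_real (normr_ge0 z))) -rmorphM.
Qed.

Lemma rnormZr c v : rnorm (c%:C *: v) = `|c| * rnorm v.
Proof. by rewrite rnormZ normc_def/= expr0n/= addr0 sqrtr_sqr. Qed.

Lemma rnorm_eq0 v : (rnorm v == 0) = (v == 0).
Proof. by rewrite -[RHS]normr_eq0 -rnormE -(inj_eq (@complexI R)). Qed.

Lemma rnorm_gt0 v : (0 < rnorm v) = (v != 0).
Proof. by rewrite lt_def rnorm_ge0 andbT rnorm_eq0. Qed.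

Lemma cvg_rnormP (x : nat -> V) v :
  x @ \oo --> v <-> rnorm (v - x n) @[n --> \oo] --> (0 : R).
Proof.
split=> [/cvgrPdist_lt xv|/cvgrPdist_lt xv].
  apply/cvgrPdist_lt => e e0; have /xv : 0 < e%:C by rewrite ltcR.
  apply: filterS => n; rewrite -rnormE ltcR => h.
  by rewrite sub0r normrN ger0_norm ?rnorm_ge0.
apply/cvgrPdist_lt => e e0.
have eE : e = (complex.Re e)%:C by rewrite RRe_real// gtr0_real.
have /xv : 0 < complex.Re e by rewrite -ltcR -eE.
apply: filterS => n; rewrite sub0r normrN ger0_norm ?rnorm_ge0// => h.
by rewrite -rnormE eE ltcR.
Qed.

Lemma cvg_rnorm_le (x : nat -> V) v (M : R) :
  x @ \oo --> v -> (\forall n \near \oo, rnorm (x n) <= M) -> rnorm v <= M.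
Proof.
move=> /cvg_rnormP xv xM; apply/ler_addgt0Pr => e e0.
have /cvgrPdist_lt/(_ _ e0) xe := xv.
have [n [nM]] := filter_ex (filterI xM xe).
rewrite sub0r normrN ger0_norm ?rnorm_ge0// => /ltW ne.
rewrite -(subrK (x n) v) (le_trans (ler_rnormD _ _))// addrC lerD//.
Qed.

End real_norm.

(** The bound [a n + a m] is what the triangle inequality gives for two approximations of one target
    with errors [a n] and [a m]; being symmetric, it asks for no order on the indices. *)
Lemma rnorm_cauchy_cvg {R : realType} {V : completeNormedModType R[i]}
    (x : nat -> V) (a : nat -> R) :
  a @ \oo --> 0 -> (forall n m, rnorm (x n - x m) <= a n + a m) ->
  exists v : V, x @ \oo --> v.
Proof.
move=> a0 xa; exists (lim (x @ \oo)).
apply/cauchy_cvgP; apply/cauchy_ballP => e e0.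
have eE : e = (complex.Re e)%:C by rewrite RRe_real// gtr0_real.
have e20 : 0 < complex.Re e / 2 by rewrite divr_gt0// -ltcR -eE.
have /cvgrPdist_lt/(_ _ e20) ae := a0.
rewrite near_map2.
near=> n m => /=; rewrite -ball_normE/= -rnormE eE ltcR.
rewrite (le_lt_trans (xa _ _))// (splitr (complex.Re e)) ltrD//.
  apply: le_lt_trans (ler_norm _) _; rewrite -normrN -sub0r.
  by near: n; exact: ae.
apply: le_lt_trans (ler_norm _) _; rewrite -normrN -sub0r.
by near: m; exact: ae.
Unshelve. all: by end_near. Qed.

Section real_inner_product.
Context {R : realType} {H : hilbertType R}.
Implicit Types (x y z : H) (c : R).

(** A symmetric real bilinear form: no conjugates appear, and [Im_innerE] recovers the imaginary
    part of [inner] from it. *)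
Definition ip x y : R := complex.Re (inner x y).

Lemma ipDl x y z : ip (x + y) z = ip x z + ip y z.
Proof. by rewrite /ip linearDl raddfD. Qed.
Lemma ipDr x y z : ip x (y + z) = ip x y + ip x z.
Proof. by rewrite /ip linearDr raddfD. Qed.
Lemma ipNl x y : ip (- x) y = - ip x y.
Proof. by rewrite /ip linearNl raddfN. Qed.
Lemma ipNr x y : ip x (- y) = - ip x y.
Proof. by rewrite /ip linearNr raddfN. Qed.
Lemma ipBl x y z : ip (x - y) z = ip x z - ip y z.
Proof. by rewrite ipDl ipNl. Qed.
Lemma ipBr x y z : ip x (y - z) = ip x y - ip x z.
Proof. by rewrite ipDr ipNr. Qed.

Lemma innerZl (w : R[i]) x y : inner (w *: x) y = w * inner x y.
Proof. exact: linearZl_LR. Qed.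
Lemma innerC x y : inner x y = (inner y x)^*.
Proof. by rewrite hermC expr0 mul1r. Qed.

Lemma ReM_real c (w : R[i]) : complex.Re (c%:C * w) = c * complex.Re w.
Proof. by case: w => p q /=; rewrite mul0r subr0. Qed.

Lemma ipC x y : ip x y = ip y x.
Proof. by rewrite /ip innerC; case: (inner y x). Qed.
Lemma ipZl c x y : ip (c%:C *: x) y = c * ip x y.
Proof. by rewrite /ip innerZl ReM_real. Qed.
Lemma ipZr c x y : ip x (c%:C *: y) = c * ip x y.
Proof. by rewrite ipC ipZl ipC. Qed.

Lemma inner_diag x : inner x x = (rnorm x ^+ 2)%:C.
Proof. by rewrite inner_norm -rnormE -rmorphXn. Qed.

Lemma ip_diag x : ip x x = rnorm x ^+ 2.
Proof. by rewrite /ip inner_diag. Qed.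

Lemma rnormB_sqr x y :
  rnorm (x - y) ^+ 2 = rnorm x ^+ 2 - 2 * ip x y + rnorm y ^+ 2.
Proof.
rewrite -!ip_diag !(ipBl, ipBr) (ipC y x); lra.
Qed.

Lemma rnormD_sqr x y :
  rnorm (x + y) ^+ 2 = rnorm x ^+ 2 + 2 * ip x y + rnorm y ^+ 2.
Proof. rewrite -!ip_diag !(ipDl, ipDr) (ipC y x); lra. Qed.

Lemma ip_le x y : ip x y <= rnorm x * rnorm y.
Proof.
have [->|y0] := eqVneq y 0.
  by rewrite rnorm0 mulr0 -(scale0r (0 : H)) (ipZr 0) mul0r.
have Y : 0 < rnorm y by rewrite rnorm_gt0.
have [->|x0] := eqVneq x 0.
  by rewrite rnorm0 mul0r -(scale0r (0 : H)) (ipZl 0) mul0r.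
have X : 0 < rnorm x by rewrite rnorm_gt0.
(* Cauchy-Schwarz: after expansion this square is twice [rnorm x * rnorm y] times the gap
   [rnorm x * rnorm y - ip x y]. *)
have := sqr_ge0 (rnorm ((rnorm y)%:C *: x - (rnorm x)%:C *: y)).
rewrite rnormB_sqr !rnormZr !(ger0_norm (rnorm_ge0 _)) ipZl ipZr.
move=> h; rewrite -(ler_pM2l (mulr_gt0 X Y)); lra.
Qed.

Lemma ler_ip_norm x y : `|ip x y| <= rnorm x * rnorm y.
Proof.
by rewrite ler_norml ip_le andbT lerNl -ipNl (le_trans (ip_le _ _))// rnormN.
Qed.

Lemma Im_innerE x y : complex.Im (inner x y) = - ip ('i *: x) y.
Proof. by rewrite /ip innerZl; case: (inner x y) => p q /=; ring. Qed.

End real_inner_product.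

(** * Self-adjoint operators and their spectrum *)

Lemma le0_cvg0 {R : realType} (r k : R) (b : nat -> R) :
  b @ \oo --> 0 -> (\forall n \near \oo, r <= k * b n) -> r <= 0.
Proof.
move=> b0 rb; have kb0 : (fun n => k * b n) @ \oo --> (0 : R).
  by rewrite -(mulr0 k); apply: cvgM => //; exact: cvg_cst.
rewrite -(cvg_lim _ kb0)//; apply: limr_ge; first by apply/cvg_ex; exists 0.
by [].
Qed.

(** Banach's fixed point theorem, by iterating [g] from 0. *)
Lemma contraction_fixpoint {R : realType} {V : completeNormedModType R[i]}
    (g : V -> V) (q : R) : 0 <= q < 1 ->
  (forall x y, rnorm (g x - g y) <= q * rnorm (x - y)) -> exists x, g x = x.
Proof.
move=> /andP[q0 q1] gq; pose x n := iter n g 0.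
(* [c] solves [c = q * c + rnorm (g 0)], so [g] preserves the ball of radius [c] around 0, which
   contains all iterates. *)
pose c := rnorm (g 0) / (1 - q).
have p0 : 0 < 1 - q by rewrite subr_gt0.
have c0 : 0 <= c by rewrite divr_ge0 ?rnorm_ge0// ltW.
have xk k : rnorm (x k - 0) <= c.
  elim: k => [|k ih]; first by rewrite subrr rnorm0.
  have -> : x k.+1 - 0 = (g (x k) - g 0) + g 0 by rewrite subrK subr0.
  rewrite (le_trans (ler_rnormD _ _))//.
  have -> : c = q * c + rnorm (g 0) by rewrite /c; field; rewrite gt_eqF.
  by rewrite lerD// (le_trans (gq _ _))// ler_wpM2l.
have xn n k : rnorm (x (n + k)%N - x n) <= q ^+ n * c.
  elim: n => [|n ih]; first by rewrite expr0 mul1r add0n.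
  by rewrite exprS -mulrA (le_trans (gq _ _))// ler_wpM2l.
have qc0 : (fun n => q ^+ n * c) @ \oo --> (0 : R).
  rewrite -(mul0r c); apply: cvgM; last exact: cvg_cst.
  by apply: cvg_expr; rewrite ger0_norm.
have [v xv] : exists v : V, x @ \oo --> v.
  apply: rnorm_cauchy_cvg qc0 _ => n m.
  wlog nm : n m / (n <= m)%N.
    move=> h; case: (leqP n m) => [|/ltnW] nm; first exact: h.
    by rewrite rnorm_distC [leRHS]addrC; apply: h.
  rewrite rnorm_distC -(subnKC nm) (le_trans (xn _ _))// lerDl.
  by rewrite mulr_ge0// exprn_ge0.
exists v; apply/eqP; rewrite -subr_eq0 -rnorm_eq0; apply/eqP/le_anti.
rewrite rnorm_ge0 andbT.
have /cvg_rnormP xv0 := xv.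
have xv1 : (fun n => rnorm (v - x n) + rnorm (v - x n.+1)) @ \oo --> (0 : R).
  rewrite -[0]addr0; apply: cvgD => //.
  by have := xv0; rewrite -cvg_shiftS.
apply: (le0_cvg0 (k := 1)) xv1 _; apply: nearW => n; rewrite mul1r.
rewrite -(subrK (x n.+1) (g v)) -addrA (le_trans (ler_rnormD _ _))// lerD//.
  by rewrite (le_trans (gq _ _))// ler_piMl ?rnorm_ge0// ltW.
by rewrite rnorm_distC.
Qed.

Section operators.
Context {R : realType} {H : hilbertType R}.
Implicit Types (A B C S T : 'B(H)) (x y : H) (c M : R).

Lemma lecR1 c : (c%:C <= 1 :> R[i]) = (c <= 1).
Proof. exact: lecR. Qed.

Lemma ler_rnorm_op A x : rnorm (A x) <= rnorm A * rnorm x.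
Proof.
have [->|x0] := eqVneq x 0; first by rewrite linear0 !rnorm0 mulr0.
have X : 0 < rnorm x by rewrite rnorm_gt0.
have := @opnorm_ub R H A ((rnorm x)^-1%:C *: x).
rewrite linearZ -!rnormE !rnormZr lecR1 lecR.
rewrite gtr0_norm ?invr_gt0// mulVf ?gt_eqF// => /(_ (lexx _)).
by rewrite mulrC ler_pdivrMr.
Qed.

Lemma rnorm_op_le A M : 0 <= M -> (forall x, rnorm (A x) <= M * rnorm x) ->
  rnorm A <= M.
Proof.
move=> M0 AM; apply: opnorm_le => x; rewrite -!rnormE lecR1 lecR => x1.
apply: le_trans (AM x) _.
by rewrite ler_piMr.
Qed.

(** Completeness of the operator norm, deduced from that of [H]: the limit is built pointwise and
    the Cauchy bound survives in it uniformly on the unit ball. *)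
Lemma bop_complete (X : nat -> 'B(H)) (a : nat -> R) :
  a @ \oo --> 0 -> (forall n m : nat, rnorm (X n - X m) <= a n + a m) ->
  exists T : 'B(H), X @ \oo --> T.
Proof.
move=> a0 Xa.
have a_ge0 n : 0 <= a n.
  by have := Xa n n; rewrite subrr rnorm0 -mulr2n pmulrn_lge0.
have Xax x n m : rnorm (X n x - X m x) <= a n * rnorm x + a m * rnorm x.
  rewrite -mulrDl; apply: le_trans (ler_rnorm_op (X n - X m) x) _.
  by rewrite ler_wpM2r ?rnorm_ge0.
have ax0 x : (fun n => a n * rnorm x) @ \oo --> (0 : R).
  by rewrite -(mul0r (rnorm x)); apply: cvgM => //; exact: cvg_cst.
have lim_ex x : exists v : H, (fun n => X n x) @ \oo --> v.
  exact: rnorm_cauchy_cvg (ax0 x) (Xax x).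
pose T x := xget 0 [set v : H | (fun n => X n x) @ \oo --> v].
have XT x : (fun n => X n x) @ \oo --> T x by exact: (xgetPex 0 (lim_ex x)).
have Tn x n : rnorm (T x - X n x) <= a n * rnorm x.
  apply/ler_addgt0Pr => e e0.
  have /cvgrPdist_lt/(_ _ e0) ae := ax0 x.
  apply: (@cvg_rnorm_le _ _ (fun m => X m x - X n x)).
    by apply: cvgB (XT x) _; exact: cvg_cst.
  apply: filterS ae => m; rewrite sub0r normrN => /(le_lt_trans (ler_norm _)) h.
  by rewrite (le_trans (Xax x m n))// addrC lerD2l ltW.
have linT : linear T.
  move=> k x y; apply: (@cvg_unique _ _ (X n (k *: x + y) @[n --> \oo])) => //.
    exact: XT.
  rewrite (_ : (fun n => _) = fun n => k *: X n x + X n y); last first.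
    by apply/funext => n; rewrite linearP.
  by apply: cvgD; [apply: cvgZr; exact: XT|exact: XT].
have bT : T \in bounded_linear_pred.
  apply/bounded_linearP; split=> //; exists (a 0%N + rnorm (X 0%N))%:C => x.
  rewrite -!rnormE -rmorphM lecR mulrDl -(subrK (X 0%N x) (T x)).
  by rewrite (le_trans (ler_rnormD _ _))// lerD// ler_rnorm_op.
exists (Bop bT); apply/cvg_rnormP.
apply: (@squeeze_cvgr _ _ _ _ (fun=> 0) a) => //; last exact: cvg_cst.
by apply: nearW => n; rewrite rnorm_ge0/= rnorm_op_le// => x; exact: Tn.
Qed.

Lemma positive_opP T : positive_op T <->
  forall x, complex.Im (inner (T x) x) = 0 /\ 0 <= ip (T x) x.
Proof.
split=> h x; have := h x; first by rewrite lecE /= => /andP[/eqP].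
by rewrite lecE/= => -[-> ->]; rewrite eqxx.
Qed.

Lemma sa_Im A x : self_adjoint A -> complex.Im (inner (A x) x) = 0.
Proof.
move=> sA; have := innerC (A x) x; rewrite -sA; case: (inner _ _) => p q /= [].
move=> /eqP; rewrite -subr_eq0 opprK -mulr2n mulrn_eq0/= => /eqP//.
Qed.

Lemma sa_ip A x y : self_adjoint A -> ip (A x) y = ip x (A y).
Proof. by move=> sA; rewrite /ip sA. Qed.

(** [positive_op] also requires the form to be real; self-adjointness supplies this, which leaves a
    comparison of real quadratic forms. *)
Lemma op_leP A B : self_adjoint A -> self_adjoint B ->
  A <=op B <-> forall x, ip (A x) x <= ip (B x) x.
Proof.
move=> sA sB; split=> [/positive_opP h x|h].
  by have [_] := h x; rewrite bopDE bopNE ipBl subr_ge0.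
apply/positive_opP => x; rewrite bopDE bopNE ipBl subr_ge0; split=> //.
by rewrite linearBl raddfB/= !sa_Im// subrr.
Qed.

Lemma sa0 : self_adjoint (0 : 'B(H)).
Proof. by move=> x y; rewrite !bop0E linear0l linear0r. Qed.

Lemma saD A B : self_adjoint A -> self_adjoint B -> self_adjoint (A + B).
Proof.
by move=> sA sB x y; rewrite !bopDE linearDl linearDr/= sA sB.
Qed.

Lemma conj_real_complex c : (c%:C)^*%R = c%:C.
Proof. exact: conjc_real. Qed.

Lemma saZ c A : self_adjoint A -> self_adjoint (c%:C *: A).
Proof.
move=> sA x y; rewrite !bopZE innerZl sA [in RHS]innerC innerZl rmorphM/=.
by rewrite -innerC conj_real_complex.
Qed.

Lemma saN A : self_adjoint A -> self_adjoint (- A).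
Proof. by move=> sA; rewrite -scaleN1r -(rmorphN1 (real_complex R)); exact: saZ. Qed.

Lemma saB A B : self_adjoint A -> self_adjoint B -> self_adjoint (A - B).
Proof. by move=> sA sB; apply: saD => //; exact: saN. Qed.

Lemma saX A n : self_adjoint A -> self_adjoint (A ^+ n).
Proof.
move=> sA; elim: n => [//|n ih] x y.
rewrite {1}exprS exprSr.
by change (inner (A ((A ^+ n) x)) y = inner x ((A ^+ n) (A y))); rewrite sA ih.
Qed.

Lemma sa_sum (I : Type) (s : seq I) (F : I -> 'B(H)) :
  (forall i, self_adjoint (F i)) -> self_adjoint (\sum_(i <- s) F i).
Proof. by move=> sF; apply: big_ind => //; [exact: sa0|exact: saD]. Qed.

Lemma sa_nabla c A B : self_adjoint A -> self_adjoint B ->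
  self_adjoint (nabla c A B).
Proof. by move=> sA sB; apply: saD; exact: saZ. Qed.

(** The imaginary parts agree as well, by the hypothesis at ['i *: x]. *)
Lemma self_adjoint_real T :
  (forall x y, ip (T x) y = ip x (T y)) -> self_adjoint T.
Proof.
move=> sT x y; apply/eqP; rewrite eq_complex; apply/andP; split; apply/eqP.
  exact: sT.
by rewrite !Im_innerE -linearZ sT.
Qed.

Lemma sa_lim (X : nat -> 'B(H)) T : (forall n, self_adjoint (X n)) ->
  X @ \oo --> T -> self_adjoint T.
Proof.
move=> sX /cvg_rnormP XT; apply: self_adjoint_real => x y.
apply/eqP; rewrite -subr_eq0 -normr_le0.
apply: (le0_cvg0 (k := 2 * rnorm x * rnorm y)) XT _; apply: nearW => n.
(* Self-adjointness of [X n] allows it to be subtracted, so the defect of [T] is at most a multiple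
   of [rnorm (T - X n)]. *)
have -> : ip (T x) y - ip x (T y) = ip ((T - X n) x) y - ip x ((T - X n) y).
  by rewrite !bopDE !bopNE ipBl ipBr (sa_ip _ _ (sX n)); ring.
have le1 : `|ip ((T - X n) x) y| <= rnorm x * rnorm y * rnorm (T - X n).
  rewrite (le_trans (ler_ip_norm _ _))// mulrAC ler_wpM2r ?rnorm_ge0// mulrC.
  exact: ler_rnorm_op.
have le2 : `|ip x ((T - X n) y)| <= rnorm x * rnorm y * rnorm (T - X n).
  rewrite (le_trans (ler_ip_norm _ _))// -mulrA.
  by rewrite ler_wpM2l ?rnorm_ge0// mulrC ler_rnorm_op.
by rewrite (le_trans (ler_normB _ _))//; lra.
Qed.

Lemma sa_horner (p : {poly R}) A : self_adjoint A -> self_adjoint (op_horner p A).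
Proof. by move=> sA; apply: sa_sum => i; apply: saZ; exact: saX. Qed.

(** Real polynomials in [A] are self-adjoint and norm limits keep this; if [is_cfc f A] is empty,
    [cfc f A] is the default 0, which is self-adjoint too. *)
Lemma sa_cfc (f : R -> R) A : self_adjoint A -> self_adjoint (cfc f A).
Proof.
move=> sA; rewrite /cfc; case: xgetP => [T -> [p _ pT]|_]; last exact: sa0.
by apply: sa_lim pT => n; exact: sa_horner.
Qed.

Lemma sa_polarization S x y : self_adjoint S ->
  4 * ip (S x) y = ip (S (x + y)) (x + y) - ip (S (x - y)) (x - y).
Proof.
move=> sS; rewrite linearD linearB !(ipDl, ipDr, ipBl, ipBr, ipNl, ipNr).
by rewrite (sa_ip y x sS) (ipC y (S x)); ring.
Qed.

(** The numerical radius bounds the norm: polarization writes [ip (S x) y] through values of the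
    form at [x + y] and [x - y], and the parallelogram law adds up their bounds. *)
Lemma sa_rnorm_le S c : self_adjoint S -> 0 <= c ->
  (forall x, `|ip (S x) x| <= c * rnorm x ^+ 2) -> rnorm S <= c.
Proof.
(* Enlarging [c] to [k > 0] makes division by [k] possible even when [c = 0]. *)
move=> sS c0 h; apply/ler_addgt0Pr => e e0; set k := c + e.
have k0 : 0 < k by rewrite ltr_wpDl.
have k0' := ltW k0.
apply: rnorm_op_le => [|x]; first exact: ltW.
have kh z : `|ip (S z) z| <= k * rnorm z ^+ 2.
  by rewrite (le_trans (h z))// ler_wpM2r ?sqr_ge0// lerDl ltW.
(* With this [y] the polarized bound reads [4 * s <= 2 * (k ^+ 2 * t + s)], where [s] and [t] are
   the squared norms of [S x] and [x]; hence [s <= k ^+ 2 * t]. *)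
set y : H := (k^-1)%:C *: S x.
have P : 4 * ip (S x) y <= 2 * k * (rnorm x ^+ 2 + rnorm y ^+ 2).
  rewrite sa_polarization//.
  have := kh (x + y); have := kh (x - y).
  rewrite !(rnormD_sqr x y) !(rnormB_sqr x y) !ler_norml => /andP[h1 _] /andP[_ h2].
  by lra.
rewrite -(ler_pXn2r (n := 2)) ?nnegrE ?mulr_ge0 ?rnorm_ge0//.
move: P; rewrite ipZr ip_diag rnormZr ger0_norm ?invr_ge0//.
rewrite !exprMn; set s := rnorm (S x) ^+ 2; set t := rnorm x ^+ 2.
have -> : 4 * (k^-1 * s) = (4 * s) / k by field; rewrite gt_eqF.
have -> : 2 * k * (t + k^-1 ^+ 2 * s) = (2 * (k ^+ 2 * t + s)) / k.
  by field; rewrite gt_eqF.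
rewrite ler_pM2r ?invr_gt0//; lra.
Qed.

(** Positivity is tested at [x - c^-1 S x]; the quadratic term there is at most
    [c^-1 * rnorm (S x) ^+ 2] and cancels half of the cross term. *)
Lemma positive_sqr_le S c x : self_adjoint S -> 0 < c -> rnorm S <= c ->
  (forall z, 0 <= ip (S z) z) -> rnorm (S x) ^+ 2 <= c * ip (S x) x.
Proof.
move=> sS c0 Sc S0; have := S0 (x - (c^-1)%:C *: S x).
rewrite linearB linearZ !(ipBl, ipBr, ipZl, ipZr) ip_diag (sa_ip (S x) x sS) ip_diag.
have : ip (S (S x)) (S x) <= c * rnorm (S x) ^+ 2.
  rewrite (le_trans (ip_le _ _))// expr2 mulrA ler_wpM2r ?rnorm_ge0//.
  by rewrite (le_trans (ler_rnorm_op _ _))// ler_wpM2r ?rnorm_ge0.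
set u := ip _ (S x); set s := rnorm _ ^+ 2; set t := ip _ x => us.
have : c^-1 * (c^-1 * u) <= c^-1 * s.
  by rewrite ler_pM2l ?invr_gt0// ler_pdivrMl.
move=> h1 h2; have : c^-1 * s <= t by lra.
by rewrite ler_pdivrMl.
Qed.

(** Lax-Milgram; the scalar [w] allows the form to be rotated until its real part is coercive.
    Coercivity gives injectivity and the bound on the inverse. Surjectivity holds because
    [x - e w (T x - y)] is a contraction in [x], whose fixed points solve [T x = y]. *)
Lemma coercive_invertible T (w : R[i]) c : w != 0 -> 0 < c ->
  (forall x, c * rnorm x ^+ 2 <= ip (w *: T x) x) ->
  exists S, S * T = 1 /\ T * S = 1.
Proof.
move=> w0 c0 coer.
have inj_bound x : rnorm x <= c^-1 * (complex.Re `|w| * rnorm (T x)).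
  have [->|x0] := eqVneq x 0.
    by rewrite linear0 !rnorm0 !mulr0.
  have X : 0 < rnorm x by rewrite rnorm_gt0.
  rewrite ler_pdivlMl// -(ler_pM2r X) -mulrA -expr2 (le_trans (coer x))//.
  by rewrite (le_trans (ip_le _ _))// rnormZ.
have injT x : T x = 0 -> x = 0.
  move=> Tx; apply/eqP; rewrite -rnorm_eq0; apply/eqP/le_anti.
  by rewrite rnorm_ge0 (le_trans (inj_bound _))// Tx rnorm0 !mulr0.
(* Adding [c] gives both [0 < n] and [c <= n]; the latter makes [q2] nonnegative. *)
pose n := rnorm (w *: T) + c.
have n0 : 0 < n by rewrite ltr_wpDl ?rnorm_ge0.
have [n0' c0'] := (ltW n0, ltW c0).
(* This [e] minimizes [1 - 2 * e * c + e ^+ 2 * n ^+ 2], the bound on the squared contraction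
   factor; the minimum is [1 - e * c]. *)
pose e := c / n ^+ 2.
have e0 : 0 < e by rewrite divr_gt0// exprn_gt0.
pose q2 := 1 - e * c.
have surT y : exists x, T x = y.
  pose g x := x - e%:C *: (w *: (T x - y)).
  have [|x1 x2|x] := @contraction_fixpoint _ _ g (Num.sqrt q2).
  - rewrite sqrtr_ge0/= -sqrtr1 ltr_sqrt//.
    by rewrite ltrBlDr ltrDl mulr_gt0.
  - have -> : g x1 - g x2 = (x1 - x2) - e%:C *: (w *: T (x1 - x2)).
      rewrite /g opprB [_ - x2]addrC addrACA; congr (_ + _).
      by rewrite addrC -scalerBr -scalerBr opprB addrA subrK [T (_ - _)]linearB
        -!scalerN opprB.
    set d := x1 - x2.
    have q20 : 0 <= q2.
      rewrite subr_ge0 /e mulrAC ler_pdivrMr ?exprn_gt0// mul1r -expr2.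
      by rewrite ler_pXn2r ?nnegrE// lerDr rnorm_ge0.
    rewrite -(ler_pXn2r (n := 2)) ?nnegrE ?mulr_ge0 ?rnorm_ge0 ?sqrtr_ge0//.
    rewrite exprMn sqr_sqrtr// rnormB_sqr rnormZr ipZr exprMn.
    rewrite (ger0_norm (ltW e0)) ipC.
    have h1 := coer d.
    have h2 : rnorm (w *: T d) ^+ 2 <= n ^+ 2 * rnorm d ^+ 2.
      rewrite -exprMn ler_pXn2r ?nnegrE ?mulr_ge0 ?rnorm_ge0//.
      rewrite (le_trans (ler_rnorm_op (w *: T) d))// ler_wpM2r ?rnorm_ge0//.
      by rewrite lerDl.
    have h3 : e ^+ 2 * rnorm (w *: T d) ^+ 2 <= e * c * rnorm d ^+ 2.
      have -> : e * c = e ^+ 2 * n ^+ 2 by rewrite /e; field; rewrite gt_eqF.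
      by rewrite -[leRHS]mulrA ler_wpM2l ?sqr_ge0.
    have h4 : e * (c * rnorm d ^+ 2) <= e * ip (w *: T d) d.
      by rewrite ler_pM2l.
    by rewrite /q2; lra.
  - move=> /eqP; rewrite /g -subr_eq0 addrAC subrr sub0r oppr_eq0 !scaler_eq0.
    rewrite (negbTE w0) subr_eq0 => /orP[/eqP[] /eqP|/orP[//|/eqP]].
      by rewrite gt_eqF.
    by exists x.
pose S y := xget 0 [set x | T x = y].
have TS y : T (S y) = y by exact: (xgetPex 0 (surT y)).
have linS : linear S.
  move=> k x y; apply/eqP; rewrite -subr_eq0; apply/eqP/injT.
  by rewrite linearB linearP/= !TS subrr.
have bS : S \in bounded_linear_pred.
  apply/bounded_linearP; split=> //; exists (c^-1 * complex.Re `|w|)%:C => x.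
  by rewrite -!rnormE -rmorphM lecR -mulrA -{2}(TS x) inj_bound.
exists (Bop bS); split; apply: bopP => x /=; last exact: TS.
apply/eqP; rewrite -subr_eq0; apply/eqP/injT.
by rewrite linearB /= TS subrr.
Qed.

End operators.

(** * Spectrum and quadratic form of a self-adjoint operator *)

Section spectral_bounds.
Context {R : realType} {H : hilbertType R}.
Implicit Types (A B C S T : 'B(H)) (x y : H) (c m M : R).

Lemma trivial_spectrum A : (forall x : H, x = 0) -> spectrum A = set0.
Proof.
move=> H0; apply/seteqP; split=> // z; apply; exists 0.
by split; apply: bopP => x; rewrite (H0 (_ x)) [RHS]H0.
Qed.

Lemma inner_shift C (w z : R[i]) x :
  inner (w *: (C - z *: (1 : 'B(H))) x) x =
  w * (inner (C x) x - z * (rnorm x ^+ 2)%:C).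
Proof.
rewrite innerZl bopDE bopNE bopZE linearBl/=; congr (_ * (_ - _)).
by rewrite innerZl inner_diag.
Qed.

(** For [z] outside the segment some multiple [w] of [C - z] is coercive, so [z] is not spectral.
    For [z] of imaginary part [q != 0] take [w = i q], which gives the constant [q ^+ 2]; for real
    [z] take [w = 1] below [m] and [w = -1] above [M]. *)
Lemma spectrum_bounds C m M : self_adjoint C ->
  (forall x, m * rnorm x ^+ 2 <= ip (C x) x <= M * rnorm x ^+ 2) ->
  spectrum C `<=` [set r%:C | r in `[m, M]%classic].
Proof.
move=> sC bC [p q] sz.
have invE w c : w != 0 -> 0 < c ->
    (forall x, c * rnorm x ^+ 2 <= ip (w *: (C - (p +i* q) *: (1 : 'B(H))) x) x) ->
    False.
  by move=> w0 c0 /(coercive_invertible w0 c0); exact: sz.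
have CE x : inner (C x) x = (ip (C x) x)%:C.
  by apply/eqP; rewrite eq_complex/= sa_Im// !eqxx.
have ipE w x : ip (w *: (C - (p +i* q) *: (1 : 'B(H))) x) x =
    complex.Re w * (ip (C x) x - p * rnorm x ^+ 2) +
    complex.Im w * (q * rnorm x ^+ 2).
  by rewrite {1}/ip inner_shift CE; case: w => u v /=; ring.
have q0 : q = 0.
  apply/eqP; apply/negPn/negP => qn0.
  have q2 : 0 < q ^+ 2 by rewrite exprn_even_gt0.
  apply: (@invE (0 +i* q) (q ^+ 2)) => //.
    by rewrite eq_complex/= negb_and qn0 orbT.
  by move=> x; rewrite ipE/=; lra.
rewrite q0 in sz invE ipE *; exists p => //=; rewrite in_itv/=.
rewrite !leNgt -negb_or; apply/negP => /orP[pm|Mp].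
  apply: (@invE 1 (m - p)) => //; first by rewrite subr_gt0.
  by move=> x; rewrite ipE/=; have /andP[? ?] := bC x; lra.
apply: (@invE (-1) (p - M)) => //; first by rewrite subr_gt0.
by move=> x; rewrite ipE/=; have /andP[? ?] := bC x; lra.
Qed.

(** [m] is the infimum of the form on the unit sphere, nonempty thanks to [x0]. Were [P = C - m]
    invertible, [positive_sqr_le] would keep the form of [P] away from 0 on the sphere, against the
    choice of [m]. *)
Lemma spectrum_lower_bound C x0 : x0 != 0 -> self_adjoint C ->
  exists2 m, spectrum C m%:C & forall x, m * rnorm x ^+ 2 <= ip (C x) x.
Proof.
move=> x00 sC; pose Q := [set ip (C x) x | x in [set x | rnorm x = 1]].
have unit x : x != 0 -> rnorm ((rnorm x)^-1%:C *: x) = 1.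
  move=> xn0; rewrite rnormZr ger0_norm ?invr_ge0 ?rnorm_ge0// mulVf//.
  by rewrite rnorm_eq0.
have Q0 : Q !=set0 by eexists; exists ((rnorm x0)^-1%:C *: x0); [exact: unit|].
have Qlb : lbound Q (- rnorm C).
  move=> _ [x x1 <-]; have := ler_ip_norm (C x) x; rewrite x1 mulr1 => h.
  have := le_trans h (ler_rnorm_op C x); rewrite x1 mulr1 ler_norml.
  by case/andP.
have Qinf : has_inf Q by split=> //; exists (- rnorm C).
have low x : inf Q * rnorm x ^+ 2 <= ip (C x) x.
  have [->|xn0] := eqVneq x 0.
    by rewrite rnorm0 expr0n mulr0 linear0 ip_diag rnorm0 expr0n.
  have x_gt0 : 0 < rnorm x by rewrite rnorm_gt0.
  have : inf Q <= ip (C ((rnorm x)^-1%:C *: x)) ((rnorm x)^-1%:C *: x).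
    apply: ge_inf; first by exists (- rnorm C).
    by exists ((rnorm x)^-1%:C *: x) => //; exact: unit.
  rewrite linearZ ipZl ipZr mulrA -expr2 exprVn mulrC ler_pdivlMr//.
  exact: exprn_gt0.
exists (inf Q) => // -[B [BP _]].
set P := C - _ in BP.
have sP : self_adjoint P by apply: saB => //; apply: saZ.
have PE x : ip (P x) x = ip (C x) x - inf Q * rnorm x ^+ 2.
  by rewrite /P bopDE bopNE bopZE ipBl ipZl ip_diag.
have P0 x : 0 <= ip (P x) x by rewrite PE subr_ge0.
pose N := rnorm P + 1.
have N0 : 0 < N by rewrite ltr_wpDl ?rnorm_ge0.
have PN : rnorm P <= N by rewrite lerDl.
(* On the sphere [1 <= rnorm B ^+ 2 * rnorm (P x) ^+ 2 <= L * ip (P x) x], so [inf Q + L^-1] would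
   still be a lower bound. The added 1 makes [L] invertible. *)
pose L := rnorm B ^+ 2 * N + 1.
have L0 : 0 < L by rewrite ltr_wpDl// mulr_ge0 ?sqr_ge0// ltW.
have : inf Q + L^-1 <= inf Q.
  apply: lb_le_inf => // _ [x x1 <-].
  have q0 := P0 x; rewrite -lerBrDl.
  have -> : ip (C x) x - inf Q = ip (P x) x by rewrite PE x1 expr1n mulr1.
  rewrite -[leLHS]mulr1 ler_pdivrMl//.
  have h : 1 <= rnorm B * rnorm (P x).
    rewrite -x1 (le_trans _ (ler_rnorm_op B (P x)))//.
    by have -> : B (P x) = x by change ((B * P) x = x); rewrite BP.
  have h2 : 1 <= rnorm B ^+ 2 * rnorm (P x) ^+ 2.
    by rewrite -exprMn exprn_ege1.
  have h3 := positive_sqr_le x sP N0 PN P0.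
  have h4 : rnorm B ^+ 2 * rnorm (P x) ^+ 2 <= rnorm B ^+ 2 * (N * ip (P x) x).
    by rewrite ler_wpM2l ?sqr_ge0.
  by rewrite /L; lra.
by rewrite gerDl leNgt invr_gt0 L0.
Qed.

Lemma spectrum_upper_bound C x0 : x0 != 0 -> self_adjoint C ->
  exists2 M, spectrum C M%:C & forall x, ip (C x) x <= M * rnorm x ^+ 2.
Proof.
move=> x00 sC; have [m sm hm] := spectrum_lower_bound x00 (saN sC).
exists (- m) => [[B [BC CB]]|x]; last first.
  by have := hm x; rewrite bopNE ipNl; lra.
have E : - C - m%:C *: (1 : 'B(H)) = - (C - (- m)%:C *: (1 : 'B(H))).
  by rewrite rmorphN/= scaleNr opprK opprD.
by apply: sm; exists (- B); rewrite E !mulrNN BC CB.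
Qed.

Lemma self_adjoint_on_nabla (I : set R) A B (t : R) : is_interval I ->
  self_adjoint_on I A -> self_adjoint_on I B -> 0 <= t <= 1 ->
  self_adjoint_on I (nabla t A B).
Proof.
move=> itvI [sA IA] [sB IB] /andP[t0 t1].
split; first exact: sa_nabla.
(* The zero space is treated apart: spectra are empty there and offer no point of [I]. *)
have [[x0 x00]|H0] := pselect (exists x : H, x != 0); last first.
  rewrite trivial_spectrum// => x; apply/eqP/negPn/negP => x0.
  by apply: H0; exists x.
have [m1 /IA[m1' Im1 [E1]] hm1] := spectrum_lower_bound x00 sA.
have [m2 /IB[m2' Im2 [E2]] hm2] := spectrum_lower_bound x00 sB.
have [M1 /IA[M1' IM1 [E3]] hM1] := spectrum_upper_bound x00 sA.
have [M2 /IB[M2' IM2 [E4]] hM2] := spectrum_upper_bound x00 sB.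
rewrite {}E1 {}E2 {}E3 {}E4 in Im1 Im2 IM1 IM2.
(* Both ends are spectral values of [A] or [B], hence points of [I], and an interval contains all
   that lies between them. *)
pose m := Num.min m1 m2; pose M := Num.max M1 M2.
have Im : I m by rewrite /m; case: leP.
have IM : I M by rewrite /M; case: leP.
have bE x : ip (nabla t A B x) x = (1 - t) * ip (A x) x + t * ip (B x) x.
  by rewrite /nabla bopDE !bopZE ipDl !ipZl.
apply: (@subset_trans _ [set r%:C | r in `[m, M]%classic]).
  apply: spectrum_bounds => [|x]; first exact: sa_nabla.
  have n0 := sqr_ge0 (rnorm x); rewrite bE.
  have mm1 : m <= m1 by rewrite ge_min lexx.
  have mm2 : m <= m2 by rewrite ge_min lexx orbT.
  have MM1 : M1 <= M by rewrite le_max lexx.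
  have MM2 : M2 <= M by rewrite le_max lexx orbT.
  have h1 : m * rnorm x ^+ 2 <= ip (A x) x by rewrite (le_trans _ (hm1 x))// ler_wpM2r.
  have h2 : m * rnorm x ^+ 2 <= ip (B x) x by rewrite (le_trans _ (hm2 x))// ler_wpM2r.
  have h3 : ip (A x) x <= M * rnorm x ^+ 2 by rewrite (le_trans (hM1 x))// ler_wpM2r.
  have h4 : ip (B x) x <= M * rnorm x ^+ 2 by rewrite (le_trans (hM2 x))// ler_wpM2r.
  have t1' : 0 <= 1 - t by rewrite subr_ge0.
  have := ler_wpM2l t1' h1; have := ler_wpM2l t0 h2.
  have := ler_wpM2l t1' h3; have := ler_wpM2l t0 h4.
  by move=> *; apply/andP; split; lra.
move=> _ [r /= + <-]; rewrite in_itv/= => mrM; exists r => //.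
exact: itvI Im IM _ mrM.
Qed.

End spectral_bounds.

(** * Bochner integrals of convex operator-valued maps *)

Section convex_unit_interval.
Context {R : realType}.
Implicit Types (g : R -> R) (s t u v w k l : R).

Definition convex01 g := forall s t l, 0 <= s <= 1 -> 0 <= t <= 1 ->
  0 <= l <= 1 -> g ((1 - l) * s + l * t) <= (1 - l) * g s + l * g t.

Lemma convex01_chord g t : convex01 g -> 0 <= t <= 1 ->
  g t <= (1 - t) * g 0 + t * g 1.
Proof.
move=> cg t01; have := cg 0 1 t; rewrite mulr0 add0r mulr1.
by apply=> //; rewrite lexx ler01.
Qed.

Lemma convex01_bounded g t : convex01 g -> 0 <= t <= 1 ->
  `|g t| <= 2 * `|g 2^-1| + `|g 0| + `|g 1|.
Proof.
move=> cg /andP[t0 t1].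
have ub u : 0 <= u -> u <= 1 -> g u <= `|g 0| + `|g 1|.
  move=> u0 u1; rewrite (le_trans (convex01_chord cg _)) ?u0//.
  have h0 := ler_norm (g 0); have h1 := ler_norm (g 1).
  have := ler_wpM2l u0 h1; have : (1 - u) * g 0 <= (1 - u) * `|g 0|.
    by rewrite ler_wpM2l// subr_ge0.
  have := mulr_ge0 u0 (normr_ge0 (g 0)).
  have : 0 <= (1 - u) * `|g 1| by rewrite mulr_ge0// subr_ge0.
  by lra.
have := ub t t0 t1.
have : g (1 - t) <= `|g 0| + `|g 1| by apply: ub; lra.
(* The lower bound comes by reflection: [2^-1] is the midpoint of [t] and [1 - t], so
   [g t >= 2 * g 2^-1 - g (1 - t)]. *)
have := cg t (1 - t) 2^-1; have -> : (1 - 2^-1) * t + 2^-1 * (1 - t) = 2^-1 by field.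
move=> h; have {h} : g 2^-1 <= (1 - 2^-1) * g t + 2^-1 * g (1 - t).
  by apply: h; lra.
have := ler_norm (g 2^-1); have := ler_norm (- g 2^-1); rewrite normrN.
have := normr_ge0 (g 0); have := normr_ge0 (g 1).
by move=> *; rewrite ler_norml; apply/andP; split; lra.
Qed.

Lemma convex01_incr g k u v w l : convex01 g ->
  (forall t, 0 <= t <= 1 -> `|g t| <= k) ->
  0 <= u <= 1 -> 0 <= w <= 1 -> 0 <= l <= 1 -> v = (1 - l) * u + l * w ->
  g v - g u <= 2 * k * l.
Proof.
move=> cg gk u01 w01 l01 ->; have := cg u w l u01 w01 l01.
have := gk u u01; have := gk w w01; rewrite !ler_norml.
move=> /andP[w1 w2] /andP[u1 u2] h; have /andP[l0 _] := l01.
have : l * (g w - g u) <= l * (2 * k) by rewrite ler_wpM2l//; lra.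
by lra.
Qed.

(** An increment from [u] to [v] is controlled by prolonging it beyond [v] to an endpoint [w] of the
    interval and applying [convex01_incr] on the segment from [u] to [w]. *)
Lemma convex01_dist g k s t : convex01 g ->
  (forall t, 0 <= t <= 1 -> `|g t| <= k) ->
  0 < t < 1 -> 0 <= s <= 1 -> `|g t - g s| <= 2 * k * (`|t - s| / (t * (1 - t))).
Proof.
move=> cg gk /andP[t0 t1] /andP[s0 s1].
have t01 : 0 <= t <= 1 by rewrite !ltW.
have k0 : 0 <= k by rewrite (le_trans _ (gk t t01)).
have p0 : 0 < t * (1 - t) by rewrite mulr_gt0// subr_gt0.
(* Two signs of the increment and two orders of [s] and [t] give four cases; the length [d] is [t],
   [1 - t], [1 - s] or [s], always at least [t * (1 - t)]. *)
have key u v w (d : R) : 0 <= u <= 1 -> 0 <= w <= 1 -> 0 < d -> t * (1 - t) <= d ->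
    0 <= (v - u) / (w - u) <= 1 -> `|w - u| = d -> `|v - u| = `|t - s| ->
    g v - g u <= 2 * k * (`|t - s| / (t * (1 - t))).
  move=> u01 w01 d0 pd l01 wud vu.
  have wu0 : w - u != 0 by rewrite -normr_eq0 wud gt_eqF.
  apply: le_trans (convex01_incr cg gk u01 w01 l01 _) _.
    by field.
  rewrite ler_wpM2l ?mulr_ge0//; have /andP[l0 _] := l01.
  rewrite -(ger0_norm l0) normrM normfV vu wud ler_wpM2l//.
  by rewrite lef_pV2 ?posrE.
have Z : 0 <= (0 : R) <= 1 by rewrite lexx ler01.
have O : 0 <= (1 : R) <= 1 by rewrite lexx ler01.
have s01 : 0 <= s <= 1 by rewrite s0.
have pt : t * (1 - t) <= t by rewrite ler_piMr ?ltW//; lra.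
have pt' : t * (1 - t) <= 1 - t by rewrite ler_piMl ?ltW//; lra.
rewrite ler_norml lerNl opprB; apply/andP; split; have [st|st] := leP s t.
- apply: (key t s 0 t) => //.
  + rewrite sub0r invrN mulrN -mulNr opprB divr_ge0 ?subr_ge0 ?(ltW t0)//=.
    by rewrite ler_pdivrMr//; lra.
  + by rewrite sub0r normrN gtr0_norm.
  + exact: distrC.
- have t1' : 0 < 1 - t by rewrite subr_gt0.
  apply: (key t s 1 (1 - t)) => //.
  + rewrite divr_ge0 ?subr_ge0 ?(ltW st) ?(ltW t1)//=.
    by rewrite ler_pdivrMr//; lra.
  + by rewrite gtr0_norm.
  + exact: distrC.
- have [s1'|s1'] := eqVneq s 1; first by move: st; rewrite s1' leNgt t1.
  have s1'' : s < 1 by rewrite lt_neqAle s1'.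
  apply: (key s t 1 (1 - s)) => //; rewrite ?subr_gt0//.
  + by apply: le_trans pt' _; lra.
  + have ? : 0 < 1 - s by rewrite subr_gt0.
    by rewrite divr_ge0 ?subr_ge0//= ler_pdivrMr//; lra.
  + by rewrite gtr0_norm// subr_gt0.
- have s0' : 0 < s by apply: lt_trans st.
  apply: (key s t 0 s) => //.
  + by rewrite (le_trans pt)// ltW.
  + rewrite sub0r invrN mulrN -mulNr opprB divr_ge0 ?subr_ge0 ?(ltW st)//=.
    by rewrite ler_pdivrMr//; lra.
  + by rewrite sub0r normrN gtr0_norm.
Qed.

(** By convexity each slope to the left of [m] is at most each slope to the right; the supremum of
    the left slopes separates them. *)
Lemma convex01_support g m : convex01 g -> 0 < m < 1 ->
  exists k, forall t, 0 <= t <= 1 -> g m + k * (t - m) <= g t.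
Proof.
move=> cg /andP[m0 m1].
have slope s t : 0 <= s < m -> m < t <= 1 ->
    (g m - g s) / (m - s) <= (g t - g m) / (t - m).
  move=> /andP[s0 sm] /andP[mt t1].
  have ms0 : 0 < m - s by rewrite subr_gt0.
  have tm0 : 0 < t - m by rewrite subr_gt0.
  have ts0 : 0 < t - s by lra.
  rewrite ler_pdivrMr// mulrAC ler_pdivlMr//.
  have := cg s t ((m - s) / (t - s)).
  have -> : (1 - (m - s) / (t - s)) * s + (m - s) / (t - s) * t = m.
    by field; rewrite gt_eqF.
  have -> : (1 - (m - s) / (t - s)) * g s + (m - s) / (t - s) * g t =
      ((t - m) * g s + (m - s) * g t) / (t - s).
    by field; rewrite gt_eqF.
  move=> h; have {h} : g m <= ((t - m) * g s + (m - s) * g t) / (t - s).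
    apply: h; [lra|lra|].
    by rewrite divr_ge0 ?(ltW ms0) ?(ltW ts0)//= ler_pdivrMr//; lra.
  rewrite ler_pdivlMr//.
  by lra.
pose S := [set (g m - g s) / (m - s) | s in [set s | 0 <= s < m]].
have S0 : S !=set0 by exists ((g m - g 0) / (m - 0)), 0; rewrite //= lexx.
have Sub : ubound S ((g 1 - g m) / (1 - m)).
  by move=> _ [s /= sm <-]; apply: slope => //; rewrite m1 lexx.
have hS : has_sup S by split=> //; exists ((g 1 - g m) / (1 - m)).
exists (sup S) => t /andP[t0 t1]; have [tm|mt|->] := ltgtP t m.
- have : (g m - g t) / (m - t) <= sup S.
    by apply: ub_le_sup; [case: hS|exists t => //=; rewrite t0].
  by rewrite ler_pdivrMr ?subr_gt0//; lra.
- have : sup S <= (g t - g m) / (t - m).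
    by apply: ge_sup => // _ [s /= sm <-]; apply: slope => //; rewrite mt.
  by rewrite ler_pdivlMr ?subr_gt0//; lra.
- by rewrite subrr mulr0 addr0.
Qed.

End convex_unit_interval.

(** The integral of a nonnegative function is a supremum over the simple functions below it, hence
    monotone without measurability. This serves for the error norms in [is_bochner], whose
    definition provides no measurability. *)
Lemma ge0_le_integral_nonmeasurable {d} {T : measurableType d} {R : realType}
    (mu : {measure set T -> \bar R}) (D : set T) (f1 f2 : T -> \bar R) :
  (forall t, D t -> 0 <= f1 t)%E -> (forall t, D t -> f1 t <= f2 t)%E ->
  (\int[mu]_(t in D) f1 t <= \int[mu]_(t in D) f2 t)%E.
Proof.
move=> f10 f12; rewrite !ge0_integralE//; last first.
  by move=> t Dt; rewrite (le_trans (f10 _ Dt)) ?f12.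
apply: le_ereal_sup => _ [h /= hf <-]; exists h => //= t.
rewrite (le_trans (hf t))// !patchE; case: ifPn => // /[!inE] Dt.
exact: f12.
Qed.

Lemma bounded_integrable {d} {T : measurableType d} {R : realType}
    (mu : {measure set T -> \bar R}) (D : set T) (f : T -> R) (k : R) :
  measurable D -> (mu D < +oo)%E -> measurable_fun D f ->
  (forall t, D t -> `|f t| <= k) -> mu.-integrable D (EFin \o f).
Proof.
move=> mD muD mf fk; apply: measurable_bounded_integrable => //.
exists k; split; first exact: num_real.
by move=> x kx t Dt; apply: le_trans (fk t Dt) (ltW kx).
Qed.

(** * Bochner integrals under real linear functionals *)

Section bochner_functional.
Context {d} {T : measurableType d} {R : realType} {V : normedModType R[i]}.
Variables (mu : {measure set T -> \bar R}) (D : set T) (mD : measurable D).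
Variable (psi : V -> R).
Hypothesis psiD : forall u v, psi (u + v) = psi u + psi v.
Hypothesis psiZ : forall (c : R) v, psi (c%:C *: v) = c * psi v.

Let psi0 : psi 0 = 0.
Proof. by rewrite -(scale0r 0) (psiZ 0) mul0r. Qed.

Lemma simple_int_functional s : simple_on mu D s ->
  mu.-integrable D (fun t => (psi (simple_val s t))%:E) /\
  (\int[mu]_(t in D) (psi (simple_val s t))%:E = (psi (simple_int mu s))%:E)%E.
Proof.
elim: s => [|[E v] s ih] hs.
  rewrite /simple_val /simple_int big_nil psi0; under eq_fun do rewrite big_nil psi0.
  by split; [exact: integrable0|rewrite integral0].
have [ih1 ih2] : mu.-integrable D (fun t => (psi (simple_val s t))%:E) /\
  (\int[mu]_(t in D) (psi (simple_val s t))%:E = (psi (simple_int mu s))%:E)%E.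
  by apply: ih => Ev Evs; apply: hs; rewrite inE Evs orbT.
have [mE ED muE] := hs (E, v) (mem_head _ _); rewrite /= in mE ED muE.
have valE t : psi (simple_val ((E, v) :: s) t) =
    \1_E t * psi v + psi (simple_val s t).
  by rewrite /simple_val big_cons psiD psiZ.
have iE : mu.-integrable D (fun t => (\1_E t)%:E).
  apply/integrableP; split; first exact/measurable_EFinP/measurable_indic.
  rewrite (eq_integral (fun x => (\1_E x)%:E)); last first.
    by move=> t _; rewrite gee0_abs// lee_fin.
  by rewrite integral_indic// setIidl.
have iEv : mu.-integrable D (fun t => (psi v)%:E * (\1_E t)%:E)%E.
  exact: integrableZl.
have -> : (fun t => (psi (simple_val ((E, v) :: s) t))%:E) =
    (fun t => (psi v)%:E * (\1_E t)%:E)%E \+ (fun t => (psi (simple_val s t))%:E).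
  by apply/funext => t /=; rewrite valE EFinD EFinM muleC.
split; first exact: integrableD.
rewrite integralD//= ih2 integralZl// integral_indic// setIidl//.
rewrite /simple_int big_cons psiD psiZ/= EFinD EFinM fineK 1?muleC//.
by rewrite ge0_fin_numE.
Qed.

(** On [D], [phi - psi s_n <= psi (F - s_n) <= rnorm (F - s_n)] for the approximating simple
    functions [s_n]. Integrating bounds the gap between the integral of [phi] and [psi] of the
    simple integral by a quantity tending to 0. *)
Lemma bochner_ge1 (F : T -> V) v (phi : T -> R) :
  (forall u, psi u <= rnorm u) -> mu.-integrable D (EFin \o phi) ->
  (forall t, D t -> phi t <= psi (F t)) -> is_bochner mu D F v ->
  (\int[mu]_(t in D) (phi t)%:E <= (psi v)%:E)%E.
Proof.
move=> psi1 iphi phiF [s [hs _ sF sv]].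
have psiB u w : psi (u - w) = psi u - psi w.
  by rewrite psiD -scaleN1r -(rmorphN1 (real_complex R)) psiZ mulN1r.
have fphi := integrable_fin_num mD iphi.
rewrite -(fineK fphi) lee_fin; set I := fine _.
have [nfin sF0] := (fine_cvgP _ _).1 sF.
have key n : ((I - psi (simple_int mu (s n)))%:E <=
    \int[mu]_(t in D) (complex.Re `|F t - simple_val (s n) t|%R)%:E)%E.
  have [is_ ints] := simple_int_functional (hs n).
  rewrite EFinB -ints /I fineK// -integralB_EFin//.
  (* Passing to the positive part makes the integrand nonnegative, as the monotonicity lemma
     requires. *)
  rewrite integralE (le_trans _ (_ : \int[mu]_(t in D)
    ((fun t => (phi t)%:E - (psi (simple_val (s n) t))%:E) ^\+ t) <= _)%E)//.
    by rewrite -[leRHS]adde0 leeD2l// oppe_le0 integral_ge0.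
  apply: ge0_le_integral_nonmeasurable => // t Dt.
  rewrite funeposE -EFinB -EFin_max lee_fin ge_max rnorm_ge0 andbT.
  by apply: le_trans (psi1 _); rewrite psiB lerB// phiF.
rewrite -subr_le0.
have /cvg_rnormP sv0 := sv.
have b0 : fine (\int[mu]_(t in D) (complex.Re `|F t - simple_val (s n) t|%R)%:E)%E
    + rnorm (v - simple_int mu (s n)) @[n --> \oo] --> (0 : R).
  by rewrite -[0]addr0; exact: cvgD.
apply: (le0_cvg0 (k := 1)) b0 _.
apply: filterS nfin => n nfin; rewrite mul1r /=.
rewrite -(subrK (psi (simple_int mu (s n))) I) -addrA lerD//.
  by rewrite -lee_fin fineK.
by rewrite -psiB rnorm_distC psi1.
Qed.

End bochner_functional.

Lemma bochner_ge {d} {T : measurableType d} {R : realType}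
    {V : normedModType R[i]} (mu : {measure set T -> \bar R}) (D : set T)
    (psi : V -> R) (F : T -> V) v (phi : T -> R) (k : R) :
  measurable D -> (forall u v, psi (u + v) = psi u + psi v) ->
  (forall (c : R) v, psi (c%:C *: v) = c * psi v) ->
  0 < k -> (forall u, psi u <= k * rnorm u) ->
  mu.-integrable D (EFin \o phi) ->
  (forall t, D t -> phi t <= psi (F t)) -> is_bochner mu D F v ->
  (\int[mu]_(t in D) (phi t)%:E <= (psi v)%:E)%E.
Proof.
move=> mD psiD psiZ k0 psik iphi phiF bF.
have iphik : mu.-integrable D (EFin \o (fun t => k^-1 * phi t)).
  by have := integrableZl mD k^-1 iphi.
have := @bochner_ge1 _ _ _ _ mu D mD (fun u => k^-1 * psi u) _ _ F v
  (fun t => k^-1 * phi t) _ iphik _ bF.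
under eq_integral do rewrite EFinM.
rewrite integralZl// EFinM lee_pmul2l ?lte_fin ?invr_gt0//; apply.
- by move=> u w; rewrite psiD mulrDr.
- by move=> c u; rewrite psiZ mulrCA.
- by move=> u; rewrite ler_pdivrMl.
- by move=> t Dt; rewrite ler_pM2l ?invr_gt0// phiF.
Qed.

(** Turns lower bounds into upper bounds, and the concave case into the convex one. *)
Lemma is_bochnerN {d} {T : measurableType d} {R : realType}
    {V : normedModType R[i]} (mu : {measure set T -> \bar R}) (D : set T)
    (F : T -> V) v :
  is_bochner mu D F v -> is_bochner mu D (\- F) (- v).
Proof.
move=> [s [hs aes sF sv]]; pose s' n := [seq (Ev.1, - Ev.2) | Ev <- s n].
have valN n t : simple_val (s' n) t = - simple_val (s n) t.
  rewrite /simple_val big_map -sumrN.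
  by apply: eq_bigr => Ev _ /=; rewrite scalerN.
have intN n : simple_int mu (s' n) = - simple_int mu (s n).
  rewrite /simple_int big_map -sumrN.
  by apply: eq_bigr => Ev _ /=; rewrite scalerN.
exists s'; split.
- by move=> n _ /mapP[Ev Evs ->]; exact: (hs n Ev Evs).
- apply: filterS aes => t h Dt; under eq_fun do rewrite valN.
  by apply: cvgN; exact: h.
- rewrite (_ : (fun n => _) = fun n => (\int[mu]_(t in D)
      (complex.Re `|F t - simple_val (s n) t|%R)%:E)%E)//.
  apply/funext => n; apply: eq_integral => t _.
  by rewrite valN opprK -normrN opprD opprK.
- by under eq_fun do rewrite intN; exact: cvgN.
Qed.

Lemma is_bochner_dirac {R : realType} {V : normedModType R[i]}
    (mu : {measure set (measurableTypeR R) -> \bar R})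
    (D : set (measurableTypeR R)) (F : R -> V) v (a : R) :
  (forall E, mu E = \d_a E) -> D a -> is_bochner mu D F v -> v = F a.
Proof.
move=> mua Da [s [hs aes _ sv]].
have valE n : simple_int mu (s n) = simple_val (s n) a.
  rewrite /simple_int /simple_val; apply: eq_bigr => Ev _.
  by rewrite mua diracE indicE.
(* The exceptional null set cannot contain [a], which carries mass 1; so the simple functions
   converge at [a] itself. *)
have [N [mN muN subN]] := aes.
have Fa : simple_val (s n) a @[n --> \oo] --> F a.
  apply: contrapT => h; have Na : N a by apply: subN => /= h'; apply: h; exact: h'.
  by move: muN; rewrite mua diracE mem_set//= => /eqP; rewrite onee_eq0.
apply: (cvg_unique _ _ Fa) => //.
by move: sv; under eq_fun do rewrite valE.
Qed.

(** * Existence of the Bochner integral by step functions *)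

Section bochner_convex.
Context {R : realType} {H : hilbertType R}.
Local Notation D := (`[0, 1]%classic : set (measurableTypeR R)).
Variable mu : {measure set (measurableTypeR R) -> \bar R}.
Hypothesis muD : (mu D < +oo)%E.
Variable F : R -> 'B(H).

Definition op_convex01 := (forall t, 0 <= t <= 1 -> self_adjoint (F t)) /\
  forall s t l, 0 <= s <= 1 -> 0 <= t <= 1 -> 0 <= l <= 1 ->
    F ((1 - l) * s + l * t) <=op nabla l (F s) (F t).

Hypothesis cF : op_convex01.

Lemma itv01_convex (s t l : R) : 0 <= s <= 1 -> 0 <= t <= 1 -> 0 <= l <= 1 ->
  0 <= (1 - l) * s + l * t <= 1.
Proof.
move=> /andP[s0 s1] /andP[t0 t1] /andP[l0 l1].
have l1' : 0 <= 1 - l by rewrite subr_ge0.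
have := mulr_ge0 l1' s0; have := mulr_ge0 l0 t0.
have := ler_wpM2l l1' s1; have := ler_wpM2l l0 t1.
by move=> *; apply/andP; split; lra.
Qed.

Lemma ip_nabla c (A B : 'B(H)) x :
  ip (nabla c A B x) x = (1 - c) * ip (A x) x + c * ip (B x) x.
Proof. by rewrite /nabla bopDE !bopZE ipDl !ipZl. Qed.

Lemma op_convex01_ip x : convex01 (fun t => ip (F t x) x).
Proof.
move=> s t l s01 t01 l01; have [sF h] := cF.
have /op_leP := h s t l s01 t01 l01.
rewrite -ip_nabla; apply; first by apply: sF; exact: itv01_convex.
by apply: sa_nabla; exact: sF.
Qed.

Let K := 2 * rnorm (F 2^-1) + rnorm (F 0) + rnorm (F 1).

Let K_ge0 : 0 <= K.
Proof. by rewrite !addr_ge0 ?mulr_ge0 ?rnorm_ge0. Qed.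

Lemma ler_ip_op (A : 'B(H)) x : `|ip (A x) x| <= rnorm A * rnorm x ^+ 2.
Proof.
rewrite (le_trans (ler_ip_norm _ _))// expr2 mulrA ler_wpM2r ?rnorm_ge0//.
exact: ler_rnorm_op.
Qed.

Lemma op_convex01_ip_bounded x t : 0 <= t <= 1 ->
  `|ip (F t x) x| <= K * rnorm x ^+ 2.
Proof.
move=> t01; apply: le_trans (convex01_bounded (op_convex01_ip x) t01) _.
by rewrite !mulrDl -mulrA !lerD ?ler_ip_op// ler_pM2l// ler_ip_op.
Qed.

Lemma op_convex01_bounded t : 0 <= t <= 1 -> rnorm (F t) <= K.
Proof.
move=> t01; apply: sa_rnorm_le => //; first exact: cF.1.
by move=> x; exact: op_convex01_ip_bounded.
Qed.

Lemma op_convex01_dist s t : 0 < t < 1 -> 0 <= s <= 1 ->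
  rnorm (F t - F s) <= 2 * K * (`|t - s| / (t * (1 - t))).
Proof.
move=> t01 s01; have [/andP[t0 t1] t01'] : 0 < t < 1 /\ 0 <= t <= 1.
  by split=> //; have /andP[/ltW -> /ltW ->] := t01.
apply: sa_rnorm_le.
- by apply: saB; exact: cF.1.
- by rewrite !mulr_ge0// invr_ge0 mulr_ge0 ?subr_ge0 ?(ltW t0) ?(ltW t1).
- move=> x; rewrite bopDE bopNE ipBl.
  apply: le_trans (convex01_dist (op_convex01_ip x) _ t01 s01) _.
    by move=> u u01; exact: op_convex01_ip_bounded.
  by rewrite le_eqVlt; apply/orP; left; apply/eqP; ring.
Qed.

(* At [t = 0] and [t = 1] the junk value [0 `^ (-1) = 0] makes [h n t] vanish,
   which is right there since the step functions below are exact at 0 and 1. *)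
Let h n (t : R) : R :=
  Num.min (2 * K) (2 * K * ((t * (1 - t)) `^ (-1) / n.+1%:R)).

Let mD : measurable D. Proof. exact: measurable_itv. Qed.

Let mh n : measurable_fun D (h n).
Proof.
apply: measurable_funTS; apply: measurable_minr; first exact: measurable_cst.
apply: measurable_funM; first exact: measurable_cst.
apply: measurable_funM; last exact: measurable_cst.
apply: (measurableT_comp (measurable_powR (-1))).
by apply: measurable_funM => //; exact: measurable_funB.
Qed.

Let h_ge0 n t : 0 <= h n t.
Proof. by rewrite le_min !mulr_ge0// ?powR_ge0// invr_ge0. Qed.

Let h_le n t : h n t <= 2 * K.
Proof. by rewrite ge_min lexx. Qed.

Let ih n : mu.-integrable D (EFin \o h n).
Proof.
apply: (@bounded_integrable _ _ _ mu D (h n) (2 * K)) => // t _.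
by rewrite ger0_norm.
Qed.

Let h_cvg t : h n t @[n --> \oo] --> (0 : R).
Proof.
apply: (@squeeze_cvgr _ _ _ _ (fun=> 0)
  (fun n => 2 * K * (t * (1 - t)) `^ (-1) * n.+1%:R^-1)).
- by apply: nearW => n; rewrite h_ge0/= ge_min mulrA lexx orbT.
- exact: cvg_cst.
- rewrite -(mulr0 (2 * K * (t * (1 - t)) `^ (-1))).
  by apply: cvgM; [exact: cvg_cst|exact: cvg_harmonic].
Qed.

Let int_h_cvg : (\int[mu]_(t in D) (h n t)%:E)%E @[n --> \oo] --> 0%E.
Proof.
rewrite -(@integral0 _ _ _ mu D).
apply: (@dominated_cvg _ _ _ mu D mD (fun n t => (h n t)%:E) (cst 0%E)
  (EFin \o cst (2 * K))).
- by move=> n; exact/measurable_EFinP.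
- by move=> t _; apply: cvg_EFin; [exact: nearW|exact: h_cvg].
- by [].
- exact: (@bounded_integrable _ _ _ mu D (cst (2 * K)) `|2 * K|).
- by move=> n t _; rewrite /= lee_fin ger0_norm.
Qed.

(** Half-open cells are disjoint and sampled at their left ends in [step]. The indices there run up
    to [n.+1], so that a last cell, reduced to the point 1, completes the cover of [D]. *)
Let cell n k : set (measurableTypeR R) :=
  `[k%:R / n.+1%:R, k.+1%:R / n.+1%:R[%classic `&` D.

Let step n := [seq (cell n k, F (k%:R / n.+1%:R)) | k <- iota 0 n.+2].

Let trunc_le n t : D t -> (Num.truncn (t * n.+1%:R) <= n.+1)%N.
Proof.
rewrite /= in_itv/= => /andP[t0 t1].
rewrite -(ler_nat R) (@le_trans _ _ (t * n.+1%:R)) ?truncn_le ?mulr_ge0//.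
by rewrite ler_piMl.
Qed.

Let step_valE n t : D t ->
  simple_val (step n) t = F ((Num.truncn (t * n.+1%:R))%:R / n.+1%:R).
Proof.
move=> Dt; have := trunc_le n Dt; set k := Num.truncn _ => kn.
have n0 : 0 < n.+1%:R :> R by rewrite ltr0n.
have t0 : 0 <= t by move: Dt; rewrite /= in_itv/= => /andP[].
rewrite /simple_val big_map (bigD1_seq k) ?iota_uniq ?mem_iota//=.
rewrite indicE mem_set; last first.
  split=> //=; rewrite in_itv/= ler_pdivrMr// ltr_pdivlMr//.
  by apply: truncn_itv; rewrite mulr_ge0.
rewrite scale1r big1 ?addr0// => j jk.
rewrite indicE memNset ?scale0r// => -[/=].
rewrite in_itv/= ler_pdivrMr// ltr_pdivlMr// => tj _.
by move: jk; rewrite /k (truncn_def tj) eqxx.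
Qed.

Let step_simple n : simple_on mu D (step n).
Proof.
move=> _ /mapP[k _ ->] /=.
have mc : measurable (cell n k) by apply: measurableI => //; exact: measurable_itv.
split=> //; first exact: subIsetr.
by apply: le_lt_trans muD; apply: le_measure; rewrite ?inE//; exact: subIsetr.
Qed.

Let step_dist n t : D t -> rnorm (F t - simple_val (step n) t) <= h n t.
Proof.
move=> Dt; rewrite step_valE//; have := trunc_le n Dt.
set k := Num.truncn _ => kn.
have n0 : 0 < n.+1%:R :> R by rewrite ltr0n.
have t01 : 0 <= t <= 1 by move: Dt; rewrite /= in_itv.
have /andP[t0 t1] := t01.
have s01 : 0 <= (k%:R / n.+1%:R : R) <= 1.
  by rewrite divr_ge0//= ler_pdivrMr// mul1r ler_nat.
have /andP[k1 k2] : k%:R <= t * n.+1%:R < k.+1%:R.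
  by apply: truncn_itv; rewrite mulr_ge0.
rewrite le_min; apply/andP; split.
  rewrite (le_trans (ler_rnormD _ _))// rnormN.
  by have := op_convex01_bounded t01; have := op_convex01_bounded s01; lra.
rewrite powR_inv1 ?mulr_ge0 ?subr_ge0//.
(* The Lipschitz bound degenerates at 0 and 1, but both are grid points and the step function is
   exact there. *)
have [t_eq|tne] := boolP ((t == 0) || (t == 1)).
  have -> : k%:R / n.+1%:R = t.
    rewrite /k; case/orP : t_eq => /eqP ->; first by rewrite mul0r truncn0 mul0r.
    by rewrite mul1r natrK divff ?gt_eqF.
  rewrite subrr rnorm0 mulr_ge0 ?mulr_ge0// ?invr_ge0// mulr_ge0 ?subr_ge0//.
have t01' : 0 < t < 1.
  by move: tne; rewrite negb_or => /andP[tn0 tn1];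
    rewrite !lt_neqAle eq_sym tn0 tn1 t0.
apply: le_trans (op_convex01_dist t01' s01) _.
rewrite ler_wpM2l ?mulr_ge0// mulrC ler_wpM2l//.
  by rewrite invr_ge0 mulr_ge0 ?subr_ge0.
rewrite ger0_norm; last by rewrite subr_ge0 ler_pdivrMr.
rewrite lerBlDr -[X in X + _]mul1r -mulrDl ler_pdivlMr// ltW//.
by rewrite addrC natr1.
Qed.

(** Step integrals are compared through their quadratic forms, which are real integrals dominated by
    those of [h n + h m]; [sa_rnorm_le] turns this into a norm estimate, and [bop_complete] gives
    the limit. *)
Lemma op_convex01_bochner : exists v, is_bochner mu D F v.
Proof.
pose a n := fine (\int[mu]_(t in D) (h n t)%:E)%E.
have aE n : (a n)%:E = (\int[mu]_(t in D) (h n t)%:E)%E.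
  by rewrite fineK//; exact: (integrable_fin_num mD (ih n)).
have a0 : a @ \oo --> (0 : R) by have [_] := (fine_cvgP _ _).1 int_h_cvg.
have sstep n : self_adjoint (simple_int mu (step n)).
  rewrite /simple_int big_map big_seq; apply: big_ind => [||k].
  - exact: sa0.
  - exact: saD.
  rewrite mem_iota add0n ltnS => kn; apply/saZ/cF.1.
  by rewrite divr_ge0//= ler_pdivrMr ?ltr0n// mul1r ler_nat.
have key n m x : ip (simple_int mu (step n) x) x - ip (simple_int mu (step m) x) x
    <= (a n + a m) * rnorm x ^+ 2.
  pose psi (S : 'B(H)) := ip (S x) x.
  have psiD S S' : psi (S + S') = psi S + psi S' by rewrite /psi bopDE ipDl.
  have psiZ c S : psi (c%:C *: S) = c * psi S by rewrite /psi bopZE ipZl.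
  have [in1 in2] := simple_int_functional mD psiD psiZ (@step_simple n).
  have [im1 im2] := simple_int_functional mD psiD psiZ (@step_simple m).
  rewrite -lee_fin EFinB -in2 -im2 -integralB_EFin//.
  rewrite mulrC EFinM EFinD !aE -integralD//=; [|exact: ih|exact: ih].
  have ihh : mu.-integrable D (fun t => (h n t)%:E + (h m t)%:E)%E.
    by apply: integrableD => //; exact: ih.
  rewrite -integralZl//; apply: le_integral => //.
  - by have := integrableB mD in1 im1.
  - exact: integrableZl.
  - move=> t /[!inE] Dt; rewrite -!EFinD -EFinM lee_fin.
    rewrite /psi -ipBl mulrC.
    apply: le_trans (ler_norm _) _; apply: le_trans (ler_ip_op (_ - _) x) _.
    rewrite ler_wpM2r ?sqr_ge0//.
    have -> : simple_val (step n) t - simple_val (step m) t =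
       (F t - simple_val (step m) t) - (F t - simple_val (step n) t).
      by rewrite opprB [RHS]addrC addrA subrK.
    by rewrite (le_trans (ler_rnormD _ _))// rnormN addrC lerD// step_dist.
have [v sv] : exists v : 'B(H), (fun n => simple_int mu (step n)) @ \oo --> v.
  apply: bop_complete a0 _ => n m; apply: sa_rnorm_le.
  - exact: saB.
  - by rewrite addr_ge0// /a fine_ge0// integral_ge0// => t _; rewrite lee_fin.
  - move=> x; rewrite bopDE bopNE ipBl ler_norml key andbT.
    by rewrite lerNl opprB [a n + _]addrC key.
exists v; exists step; split=> //.
- apply: aeW => t Dt; apply/cvg_rnormP.
  apply: (@squeeze_cvgr _ _ _ _ (fun=> 0) (h ^~ t)) => //.
  + by apply: nearW => n; rewrite rnorm_ge0 step_dist.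
  + exact: cvg_cst.
- apply: (@squeeze_cvge _ _ _ _ (fun=> 0%E) _
    (fun n => \int[mu]_(t in D) (h n t)%:E)%E) => //; last exact: cvg_cst.
  apply: nearW => n; apply/andP; split.
    by apply: integral_ge0 => t _; rewrite lee_fin;
      exact: (rnorm_ge0 (F t - simple_val (step n) t)).
  apply: ge0_le_integral_nonmeasurable => t Dt; rewrite lee_fin.
    exact: (rnorm_ge0 (F t - simple_val (step n) t)).
  exact: (step_dist n Dt).
Qed.

End bochner_convex.

(** * The measures eta *)

Section eta_integral.
Context {R : realType}.
Local Notation leb := (@lebesgue_measure R).
Local Notation D := (`[0, 1]%classic : set (measurableTypeR R)).

Let powR_derivable (c x : R) : 0 < x -> derivable (fun y : R => y `^ c) x 1.
Proof. by move=> x0; apply: derivable_powR; rewrite in_itv/= x0. Qed.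

Let powR_continuous (c x : R) : 0 < x -> {for x, continuous (fun y : R => y `^ c)}.
Proof.
by move=> x0; apply/differentiable_continuous/derivable1_diffP/powR_derivable.
Qed.

Lemma integral_powR_itvcc (c e : R) : 0 < e < 1 ->
  (\int[leb]_(t in `[e, 1%R]) (c * t `^ (c - 1))%:E = (1 - e `^ c)%:E)%E.
Proof.
move=> /andP[e0 e1].
rewrite (@continuous_FTC2 _ _ (fun y : R => y `^ c))//.
- by rewrite powR1 -EFinB.
- apply: continuous_in_subspaceT => x; rewrite inE/= in_itv/= => /andP[ex _].
  have : {for (x : R), continuous (fun y : R => c * y `^ (c - 1))}; last by [].
  apply: cvgM; first exact: cvg_cst.
  by apply: powR_continuous; exact: lt_le_trans ex.
- split.
  + move=> x; rewrite in_itv/= => /andP[ex _].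
    by apply: powR_derivable; exact: lt_trans ex.
  + by apply: cvg_at_right_filter; exact: powR_continuous.
  + by apply: cvg_at_left_filter; exact: powR_continuous.
- move=> x; rewrite in_itv/= => /andP[ex _]; rewrite powR_derive1//.
  by rewrite in_itv/= (lt_trans e0 ex).
Qed.

(** For [c < 1] the integrand is unbounded near 0, so the fundamental theorem is used on [[e n, 1]]
    and followed by monotone convergence. *)
Lemma integral_powR01 (c : R) : 0 < c ->
  (\int[leb]_(t in D) (c * t `^ (c - 1))%:E = 1)%E.
Proof.
move=> c0.
have mf (A : set (measurableTypeR R)) :
    measurable_fun A (fun t : R => (c * t `^ (c - 1))%:E).
  by apply/measurable_EFinP/measurable_funTS; exact: measurable_funM.
rewrite -integral_itv_obnd_cbnd; last exact: mf.
(* chosen so that the primitive t^c takes the value 1 / (n + 2) at e n *)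
pose e n : R := n.+2%:R^-1 `^ c^-1.
have n0 n : 0 < n.+2%:R^-1 :> R by rewrite invr_gt0 ltr0n.
have ec n : e n `^ c = n.+2%:R^-1.
  by rewrite /e -powRrM mulVf ?gt_eqF// powRr1// ltW.
have e0 n : 0 < e n by exact: powR_gt0.
have e1 n : e n < 1.
  rewrite -[ltRHS](_ : 1 `^ c^-1 = 1); last by rewrite powR1.
  by rewrite gt0_ltr_powR ?invr_gt0 ?nnegrE// ?invf_lt1 ?ltr1n// ltW.
pose E n : set (measurableTypeR R) := `[e n, 1]%classic.
have ndE : nondecreasing_seq E.
  move=> n m nm; rewrite subsetEset => x; rewrite /E/= !in_itv/= => /andP[ex ->].
  rewrite andbT (le_trans _ ex)// ge0_ler_powR ?invr_ge0 ?nnegrE ?(ltW c0)//.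
  by rewrite lef_pV2 ?posrE ?ltr0n// ler_nat.
have UE : \bigcup_n E n = `]0, 1]%classic.
  apply/seteqP; split=> [x [n _]|x]; rewrite /E/= !in_itv/= => /andP[x1 x2].
    by rewrite x2 (lt_le_trans (e0 n) x1).
  have xc : 0 < x `^ c by exact: powR_gt0.
  exists (Num.truncn (x `^ c)^-1) => //=; rewrite in_itv/= x2 andbT.
  rewrite -[leRHS](_ : (x `^ c) `^ c^-1 = x); last first.
    by rewrite -powRrM divff ?gt_eqF// powRr1// ltW.
  rewrite ge0_ler_powR ?invr_ge0 ?nnegrE ?(ltW c0) ?(ltW xc)//.
  rewrite -[leRHS]invrK lef_pV2 ?posrE ?invr_gt0 ?ltr0n//.
  rewrite (le_trans (ltW (truncnS_gt _)))// ler_nat//.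
have cvg1 : (\int[leb]_(t in E n) (c * t `^ (c - 1))%:E)%E @[n --> \oo] --> 1%E.
  rewrite (_ : (fun n => _) = fun n => (1 - n.+2%:R^-1)%:E); last first.
    by apply/funext => n; rewrite integral_powR_itvcc ?e0 ?e1// ec.
  apply: cvg_EFin; first exact: nearW.
  rewrite -[X in _ --> X]subr0; apply: cvgB; first exact: cvg_cst.
  by have := @cvg_harmonic R; rewrite -cvg_shiftS.
apply: (cvg_unique _ _ cvg1) => //; rewrite -UE.
apply: ge0_nondecreasing_set_cvg_integral => //.
- by move=> n; exact: measurable_itv.
- by move=> n t _; rewrite lee_fin mulr_ge0 ?powR_ge0// ltW.
Qed.

Lemma eta_mass (l : R) : 0 < l < 1 -> eta l D = 1%E.
Proof.
move=> /andP[l0 l1]; rewrite /eta leNgt l0/= leNgt l1/= setIid.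
have d0 : 0 < 1 - l by rewrite subr_gt0.
rewrite -[RHS](@integral_powR01 (l / (1 - l))) ?divr_gt0//.
apply: eq_integral => t _; rewrite /eta_pdf.
(* With [c = l / (1 - l)] the density is [c * t^(c - 1)], the derivative of [t^c]. *)
by have -> : l / (1 - l) - 1 = (2 * l - 1) / (1 - l) by field; rewrite gt_eqF.
Qed.

Import HBNNSimple.

(** [eta l] is defined on sets only, so integration against its density is derived from indicators
    to simple functions and then by monotone convergence. *)
Lemma ge0_integral_eta (l : R) (f : measurableTypeR R -> \bar R) :
  0 < l < 1 -> measurable_fun setT f -> (forall t, 0 <= f t)%E ->
  (\int[eta l]_(t in D) f t = \int[leb]_(t in D) (f t * (eta_pdf l t)%:E))%E.
Proof.
move=> /andP[l0 l1] mf f0.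
have pdf0 t : (0 <= (eta_pdf l t)%:E)%E by rewrite lee_fin eta_pdf_ge0.
have mpdf (A : set (measurableTypeR R)) : measurable_fun A (fun t => (eta_pdf l t)%:E).
  apply/measurable_EFinP; apply: measurable_funTS.
  exact: measurable_eta_pdf.
have mD : measurable D by exact: measurable_itv.
have Hindic (E : set (measurableTypeR R)) : measurable E ->
    (\int[eta l]_(t in D) (\1_E t)%:E =
     \int[leb]_(t in D) ((\1_E t)%:E * (eta_pdf l t)%:E))%E.
  move=> mE; rewrite integral_indic//= /eta leNgt l0/= leNgt l1/= -setIA setIid.
  rewrite setIC integral_mkcondr; apply: eq_integral => t _.
  by rewrite patchE indicE; case: ifPn; rewrite ?mul1e ?mul0e.
have Hsfun (h : {nnsfun measurableTypeR R >-> R}) :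
    (\int[eta l]_(t in D) (h t)%:E =
     \int[leb]_(t in D) ((h t)%:E * (eta_pdf l t)%:E))%E.
  under [LHS]eq_integral do rewrite fimfunE -fsumEFin//.
  rewrite [LHS]ge0_integral_fsum//; last 2 first.
  - by move=> r; exact/measurable_EFinP/measurableT_comp.
  - by move=> n x _; rewrite EFinM nnfun_muleindic_ge0.
  under [RHS]eq_integral.
    move=> x xD; rewrite fimfunE -fsumEFin// ge0_mule_fsuml; last first.
      by move=> r; rewrite EFinM nnfun_muleindic_ge0.
    over.
  rewrite [RHS]ge0_integral_fsum//; last 2 first.
  - move=> r; apply: emeasurable_funM => //.
    exact/measurable_EFinP/measurableT_comp.
  - by move=> n x _; rewrite EFinM mule_ge0// nnfun_muleindic_ge0.
  apply: eq_fsbigr => r rh.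
  under [RHS]eq_integral do rewrite EFinM -muleA.
  rewrite integralZl_indic_nnsfun//= Hindic//.
  have [r0|r0] := ltP r 0.
    rewrite preimage_nnfun0//.
    under eq_integral do rewrite indic0 mul0e.
    under [RHS]eq_integral do rewrite indic0 mul0e mule0.
    by rewrite integral0 mule0.
  rewrite ge0_integralZl//.
  - apply: emeasurable_funM => //; exact/measurable_EFinP.
  - by move=> t _; rewrite mule_ge0// lee_fin.
pose f_ := nnsfun_approx measurableT mf.
transitivity (limn (fun n => \int[eta l]_(t in D) (f_ n t)%:E)%E).
  rewrite -monotone_convergence//=.
  - apply: eq_integral => t _; apply/esym/cvg_lim => //.
    exact: cvg_nnsfun_approx.
  - by move=> n; exact/measurable_EFinP/measurable_funTS.
  - by move=> n t _; rewrite lee_fin.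
  - by move=> t _ n m nm; rewrite lee_fin; exact/lefP/nd_nnsfun_approx.
transitivity (limn (fun n => \int[leb]_(t in D) ((f_ n t)%:E * (eta_pdf l t)%:E))%E).
  by apply: congr_lim; apply/funext => n /=; exact: Hsfun.
rewrite -monotone_convergence//=.
- apply: eq_integral => t _; apply/cvg_lim => //.
  by apply: cvgeZr => //; exact: cvg_nnsfun_approx.
- by move=> n; apply: emeasurable_funM => //; exact/measurable_EFinP/measurable_funTS.
- by move=> n t _; rewrite mule_ge0// lee_fin.
- move=> t _ n m nm; rewrite lee_wpmul2r// lee_fin; exact/lefP/nd_nnsfun_approx.
Qed.

Lemma eta_mean (l : R) : 0 < l < 1 -> (\int[eta l]_(t in D) t%:E = l%:E)%E.
Proof.
move=> l01; have /andP[l0 l1] := l01.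
have d0 : 0 < 1 - l by rewrite subr_gt0.
pose c := l / (1 - l); have c0 : 0 < c by rewrite divr_gt0.
(* [ge0_integral_eta] asks for nonnegativity on the whole line; the absolute value agrees with [t]
   on [D]. *)
transitivity (\int[eta l]_(t in D) (`|t|%R)%:E)%E.
  apply: eq_integral => t; rewrite inE/= in_itv/= => /andP[t0 _].
  by rewrite ger0_norm.
rewrite ge0_integral_eta//; last first.
  apply/measurable_EFinP; exact: (@normr_measurable R setT).
(* Here [t * (c * t^(c - 1)) = c * t^c], and [c = l * (c + 1)] exhibits [l] times a density of mass
   1. *)
transitivity (\int[leb]_(t in D) (l%:E * ((c + 1) * t `^ (c + 1 - 1))%:E))%E.
  apply: eq_integral => t; rewrite inE/= in_itv/= => /andP[t0 _].
  rewrite -!EFinM ger0_norm// addrK /eta_pdf -/c.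
  have -> : (2 * l - 1) / (1 - l) = c - 1 by rewrite /c; field; rewrite gt_eqF.
  rewrite mulrCA mulr_powRB1// mulrA; congr (_ * _)%:E.
  by rewrite /c; field; rewrite gt_eqF.
have c10 : 0 < c + 1 by rewrite addr_gt0.
rewrite ge0_integralZl//=.
- by rewrite integral_powR01// mule1.
- by apply/measurable_EFinP/measurable_funTS; exact: measurable_funM.
- by move=> t _; rewrite lee_fin mulr_ge0 ?powR_ge0// ltW.
- by rewrite lee_fin ltW.
Qed.

Lemma eta_affine (l c k : R) : 0 < l < 1 ->
  (\int[eta l]_(t in D) (c + k * t)%:E = (c + k * l)%:E)%E.
Proof.
move=> l01; have mD : measurable D by exact: measurable_itv.
have m1 := eta_mass l01.
have mfin : (eta l D < +oo)%E by rewrite m1 ltry.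
have it : (eta l).-integrable D (EFin \o (fun t : R => t)).
  apply: (@bounded_integrable _ _ _ (eta l) D _ 1) => //.
  by move=> t; rewrite /= in_itv/= => /andP[t0 t1]; rewrite ger0_norm.
under eq_integral do rewrite EFinD EFinM.
rewrite integralD//=; last 2 first.
- by apply: (@bounded_integrable _ _ _ (eta l) D (cst c) `|c|) => //.
- exact: integrableZl.
rewrite integralZl// eta_mean// EFinD EFinM; congr (_ + _)%E.
by rewrite integral_cst// -[RHS]mule1; congr (_ * _)%E; exact: m1.
Qed.

End eta_integral.

(** * Hermite-Hadamard inequalities *)

Lemma integral_mscale {d} {T : measurableType d} {R : realType}
    (mu : {measure set T -> \bar R}) (D : set T) (k : {nonneg R})
    (f : T -> \bar R) :
  measurable D -> mu.-integrable D f ->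
  (\int[mscale k mu]_(t in D) f t = k%:num%:E * \int[mu]_(t in D) f t)%E.
Proof.
move=> mD intf; have mf := measurable_int mu intf.
rewrite [LHS]integralE [X in (_ * X)%E]integralE muleBr//; last first.
  exact: integrable_add_def.
rewrite !ge0_integral_mscale//; first exact: measurable_funeneg.
exact: measurable_funepos.
Qed.

Section eta_sigma.
Context {R : realType}.
Local Notation D := (`[0, 1]%classic : set (measurableTypeR R)).
Variables (l : R) (a : {i01 R}).
Hypothesis l01 : 0 < l < 1.

Lemma i01_itv : 0 <= a%:num <= 1.
Proof. by apply/andP; split. Qed.

Lemma eta0E (E : set (measurableTypeR R)) : eta 0 E = \d_(0 : R) E.
Proof. by rewrite /eta lexx. Qed.

Lemma eta1E (E : set (measurableTypeR R)) : eta 1 E = \d_(1 : R) E.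
Proof. by rewrite /eta ler10 lexx. Qed.

Lemma eta_lty (b : R) : 0 <= b <= 1 -> (eta b D < +oo)%E.
Proof.
rewrite !le_eqVlt => /andP[/predU1P[<- _|b0 /predU1P[->|b1]]].
- by rewrite eta0E diracE ltry.
- by rewrite eta1E diracE ltry.
- by rewrite eta_mass ?b0// ltry.
Qed.

Lemma onem01 : 0 < 1 - l < 1.
Proof. by move: l01 => /andP[? ?]; apply/andP; split; lra. Qed.

Lemma mscale_lty (mu : {measure set (measurableTypeR R) -> \bar R})
    (k : {nonneg R}) : (mu D < +oo)%E -> (mscale k mu D < +oo)%E.
Proof.
by move=> muD; rewrite /mscale/= lte_mul_pinfty// lee_fin.
Qed.

Lemma sigma_lty : (sigma l a D < +oo)%E.
Proof.
rewrite [X in (X < _)%E](measure_addE (mscale (1 - a%:num)%:nng (eta l))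
  (mscale a%:num%:nng (eta (1 - l))) D).
by rewrite lte_add_pinfty//; apply: mscale_lty; apply: eta_lty;
  [have /andP[] := l01|have /andP[] := onem01] => *; rewrite !ltW.
Qed.

Lemma integral_sigma (f : R -> R) (k : R) : measurable_fun D f ->
  (forall t, D t -> `|f t| <= k) ->
  (\int[sigma l a]_(t in D) (f t)%:E =
   (1 - a%:num)%:E * \int[eta l]_(t in D) (f t)%:E +
   a%:num%:E * \int[eta (1 - l)]_(t in D) (f t)%:E)%E.
Proof.
move=> mf fk; have mD : measurable D by exact: measurable_itv.
have e1 : (eta l D < +oo)%E.
  by apply: eta_lty; have /andP[? ?] := l01; rewrite !ltW.
have e2 : (eta (1 - l) D < +oo)%E.
  by apply: eta_lty; have /andP[? ?] := onem01; rewrite !ltW.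
rewrite /sigma [LHS]integral_measure_add//.
- by rewrite !integral_mscale//; exact: (bounded_integrable (k := k)).
- by apply: (bounded_integrable (k := k)) => //; exact: mscale_lty.
- by apply: (bounded_integrable (k := k)) => //; exact: mscale_lty.
Qed.

End eta_sigma.

Section bochner_operator.
Context {d} {T : measurableType d} {R : realType} {H : hilbertType R}.
Variables (mu : {measure set T -> \bar R}) (D : set T) (mD : measurable D).
Implicit Types (F : T -> 'B(H)) (v : 'B(H)).

Lemma is_bochner_sa F v : (forall t, D t -> self_adjoint (F t)) ->
  is_bochner mu D F v -> self_adjoint v.
Proof.
move=> sF bv; apply: self_adjoint_real => x y.
(* [bochner_ge] only gives lower bounds; the signs [c = 1] and [c = -1] together force equality. *)
pose psi (c : R) (S : 'B(H)) := c * (ip (S x) y - ip x (S y)).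
have psi_ge0 c : `|c| <= 1 -> 0 <= psi c v.
  move=> c1; rewrite -lee_fin.
  have := @bochner_ge _ _ _ _ mu D (psi c) F v (cst 0) (2 * rnorm x * rnorm y + 1)
    mD _ _ _ _ _ _ bv.
  rewrite integral0; apply.
  - by move=> S S'; rewrite /psi !bopDE ipDl ipDr; ring.
  - by move=> r S; rewrite /psi !bopZE ipZl ipZr; ring.
  - by rewrite ltr_wpDl// !mulr_ge0// rnorm_ge0.
  - move=> S; apply: le_trans (ler_norm _) _; rewrite normrM.
    apply: le_trans (ler_piMl (normr_ge0 _) c1) _.
    apply: le_trans (ler_normB _ _) _.
    have h1 : `|ip (S x) y| <= rnorm S * rnorm x * rnorm y.
      apply: le_trans (ler_ip_norm _ _) _.
      by rewrite ler_wpM2r ?rnorm_ge0// ler_rnorm_op.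
    have h2 : `|ip x (S y)| <= rnorm x * (rnorm S * rnorm y).
      apply: le_trans (ler_ip_norm _ _) _.
      by rewrite ler_wpM2l ?rnorm_ge0// ler_rnorm_op.
    by have := rnorm_ge0 S; lra.
  - exact: integrable0.
  - by move=> t Dt; rewrite /psi (sa_ip _ _ (sF t Dt)) subrr mulr0.
apply/eqP; rewrite -subr_eq0; apply/eqP/le_anti.
have := psi_ge0 1; have := psi_ge0 (-1); rewrite /psi normrN normr1 lexx.
by move=> /(_ isT) h1 /(_ isT) h2; apply/andP; split; lra.
Qed.

(** The added 1 keeps the constant positive at [x = 0], as [bochner_ge] demands. *)
Let kx (x : H) : R := rnorm x ^+ 2 + 1.

Let kx_gt0 x : 0 < kx x.
Proof. by rewrite ltr_wpDl// sqr_ge0. Qed.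

Let kx_le x (S : 'B(H)) : `|ip (S x) x| <= kx x * rnorm S.
Proof.
apply: le_trans (ler_ip_op _ _) _; rewrite mulrC ler_wpM2r ?rnorm_ge0//.
by rewrite lerDl.
Qed.

Lemma bochner_ip_ge F v (phi : T -> R) x : is_bochner mu D F v ->
  mu.-integrable D (EFin \o phi) -> (forall t, D t -> phi t <= ip (F t x) x) ->
  (\int[mu]_(t in D) (phi t)%:E <= (ip (v x) x)%:E)%E.
Proof.
move=> bv iphi phiF.
apply: (bochner_ge (psi := fun S : 'B(H) => ip (S x) x) (k := kx x)) bv => //.
- by move=> S S'; rewrite bopDE ipDl.
- by move=> c S; rewrite bopZE ipZl.
- by move=> S; exact: le_trans (ler_norm _) (kx_le x S).
Qed.

Lemma bochner_ip_le F v (phi : T -> R) x : is_bochner mu D F v ->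
  mu.-integrable D (EFin \o phi) -> (forall t, D t -> ip (F t x) x <= phi t) ->
  ((ip (v x) x)%:E <= \int[mu]_(t in D) (phi t)%:E)%E.
Proof.
move=> /is_bochnerN bv iphi Fphi.
have iN : mu.-integrable D (EFin \o (fun t => - phi t)).
  exact: (integrableN iphi).
have := @bochner_ip_ge _ _ _ x bv iN.
rewrite bopNE ipNl; under eq_integral do rewrite EFinN.
rewrite integralN; last exact: integrable_add_def.
rewrite EFinN leeN2; apply=> t Dt.
by rewrite bopNE ipNl lerN2 Fphi.
Qed.

End bochner_operator.

Section nabla_theory.
Context {R : realType} {H : hilbertType R}.
Implicit Types A B : 'B(H).

Lemma op_le_refl A : A <=op A.
Proof. by move=> x; rewrite subrr bop0E linear0l. Qed.

Lemma op_leN A B : - B <=op - A -> A <=op B.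
Proof. by rewrite /op_le opprK addrC. Qed.

Lemma nabla0 A B : nabla 0 A B = A.
Proof. by rewrite /nabla subr0 scale1r scale0r addr0. Qed.

Lemma nabla1 A B : nabla 1 A B = B.
Proof. by rewrite /nabla subrr scale1r scale0r add0r. Qed.

Lemma nablaN l A B : nabla l (- A) (- B) = - nabla l A B.
Proof. by rewrite /nabla !scalerN opprD. Qed.

Lemma nabla_nabla l s t A B :
  nabla l (nabla s A B) (nabla t A B) = nabla ((1 - l) * s + l * t) A B.
Proof.
rewrite /nabla !scalerDr !scalerA addrACA -!scalerDl -!rmorphM -!rmorphD.
by congr (_%:C *: _ + _%:C *: _); ring.
Qed.

End nabla_theory.

Section jensen_chain.
Context {R : realType} {H : hilbertType R}.
Local Notation D := (`[0, 1]%classic : set (measurableTypeR R)).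
Implicit Types (F : R -> 'B(H)) (v : 'B(H)).

Let mD : measurable D. Proof. exact: measurable_itv. Qed.

Let D01 t : D t -> 0 <= t <= 1.
Proof. by rewrite /= in_itv. Qed.

Let affine_bounded (c k t : R) : D t -> `|c + k * t| <= `|c| + `|k|.
Proof.
move=> /D01/andP[t0 t1]; apply: le_trans (ler_normD _ _) _.
by rewrite lerD2l normrM ler_piMr// ger0_norm.
Qed.

Let measurable_affine (c k : R) : measurable_fun D (fun t : R => c + k * t).
Proof.
by apply: measurable_funTS; apply: measurable_funD => //; exact: measurable_funM.
Qed.

(** For [b] in the open interval, [eta b] has mass 1 and mean [b]: the supporting line at [b]
    integrates to its value there, and the chord to its value at [b]. At [b = 0] and [b = 1] the
    measure is Dirac, so [v] equals [F b]. *)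
Lemma eta_hermite_hadamard F v (b : R) : 0 <= b <= 1 -> op_convex01 F ->
  is_bochner (eta b) D F v -> F b <=op v /\ v <=op nabla b (F 0) (F 1).
Proof.
move=> b01 cF bv; have /andP[] := b01; rewrite !le_eqVlt.
move=> /predU1P[b0 _|b0 /predU1P[b1|b1]].
- rewrite -b0 in bv *; rewrite nabla0.
  have -> : v = F 0.
    by apply: is_bochner_dirac bv; [exact: eta0E|rewrite /= in_itv/= lexx ler01].
  by split; exact: op_le_refl.
- rewrite b1 in bv *; rewrite nabla1.
  have -> : v = F 1.
    by apply: is_bochner_dirac bv; [exact: eta1E|rewrite /= in_itv/= lexx ler01].
  by split; exact: op_le_refl.
have b01' : 0 < b < 1 by rewrite b0.
have sF t : D t -> self_adjoint (F t) by move=> /D01; exact: cF.1.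
have sv := is_bochner_sa mD sF bv.
have i1 c k : (eta b).-integrable D (EFin \o (fun t : R => c + k * t)).
  apply: (bounded_integrable (k := `|c| + `|k|)) => //.
  - exact: eta_lty.
  - by move=> t; exact: affine_bounded.
have s0 : self_adjoint (F 0) by apply: cF.1; rewrite lexx ler01.
have s1 : self_adjoint (F 1) by apply: cF.1; rewrite lexx ler01.
split; apply/op_leP => //; try by [exact: cF.1|exact: sa_nabla].
  move=> x; have [k hk] := convex01_support (op_convex01_ip cF x) b01'.
  set gb := ip (F b x) x in hk *.
  have := bochner_ip_ge mD bv (i1 (gb - k * b) k) (x := x).
  rewrite eta_affine// subrK lee_fin; apply=> t /D01 t01.
  by apply: le_trans (hk t t01); lra.
move=> x; rewrite ip_nabla.
have := bochner_ip_le mD bv (i1 (ip (F 0 x) x) (ip (F 1 x) x - ip (F 0 x) x)) (x := x).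
rewrite eta_affine// lee_fin => h.
apply: le_trans (h _) _; last by lra.
by move=> t /D01 t01; have := convex01_chord (op_convex01_ip cF x) t01; lra.
Qed.

Lemma sigma_hermite_hadamard F v (l : R) (a : {i01 R}) : 0 < l < 1 ->
  op_convex01 F -> is_bochner (sigma l a) D F v ->
  nabla a%:num (F l) (F (1 - l)) <=op v /\
  v <=op nabla (r_weight l a%:num) (F 0) (F 1).
Proof.
move=> l01 cF bv; have l01' := onem01 l01.
have /andP[a0 a1] := i01_itv a.
have sF t : D t -> self_adjoint (F t) by move=> /D01; exact: cF.1.
have sv := is_bochner_sa mD sF bv.
have s0 : self_adjoint (F 0) by apply: cF.1; rewrite lexx ler01.
have s1 : self_adjoint (F 1) by apply: cF.1; rewrite lexx ler01.
have sl : self_adjoint (F l) by apply: cF.1; have /andP[? ?] := l01; rewrite !ltW.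
have sl' : self_adjoint (F (1 - l)).
  by apply: cF.1; have /andP[? ?] := l01'; rewrite !ltW.
have muD := sigma_lty a l01.
split; apply/op_leP => //; try exact: sa_nabla.
  move=> x; rewrite ip_nabla.
  have [k1 hk1] := convex01_support (op_convex01_ip cF x) l01.
  have [k2 hk2] := convex01_support (op_convex01_ip cF x) l01'.
  set g1 := ip (F l x) x in hk1 *; set g2 := ip (F (1 - l) x) x in hk2 *.
  pose L1 (t : R) := (g1 - k1 * l) + k1 * t.
  pose L2 (t : R) := (g2 - k2 * (1 - l)) + k2 * t.
  (* One minorant must serve both components of [sigma], whose means are [l] and [1 - l]. The
     maximum stays below the form and dominates, on each component, the line supporting at its
     mean. *)
  pose phi t := Num.max (L1 t) (L2 t).
  pose M := (`|g1 - k1 * l| + `|k1|) + (`|g2 - k2 * (1 - l)| + `|k2|).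
  have mphi : measurable_fun D phi.
    by apply: measurable_maxr; exact: measurable_affine.
  have phiM t : D t -> `|phi t| <= M.
    move=> Dt; have h1 := affine_bounded (g1 - k1 * l) k1 Dt.
    have h2 := affine_bounded (g2 - k2 * (1 - l)) k2 Dt.
    have [->|->] : phi t = L1 t \/ phi t = L2 t.
      by rewrite /phi; case: leP; [right|left].
      by apply: le_trans h1 _; rewrite lerDl addr_ge0.
    by apply: le_trans h2 _; rewrite lerDr addr_ge0.
  have iphi (mu : {measure set (measurableTypeR R) -> \bar R}) :
      (mu D < +oo)%E -> mu.-integrable D (EFin \o phi).
    by move=> h; apply: (bounded_integrable (k := M)).
  have phig t : D t -> phi t <= ip (F t x) x.
    move=> /D01 t01; rewrite ge_max; apply/andP; split.
      by apply: le_trans (hk1 t t01); rewrite /L1; lra.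
    by apply: le_trans (hk2 t t01); rewrite /L2; lra.
  have := bochner_ip_ge mD bv (iphi _ muD) phig.
  rewrite (integral_sigma a l01 mphi phiM) -lee_fin; apply: le_trans.
  have e1 : (eta l D < +oo)%E by apply: eta_lty; have /andP[? ?] := l01; rewrite !ltW.
  have e2 : (eta (1 - l) D < +oo)%E.
    by apply: eta_lty; have /andP[? ?] := l01'; rewrite !ltW.
  rewrite EFinD !EFinM; apply: leeD; apply: lee_wpmul2l; rewrite ?lee_fin ?subr_ge0//.
    rewrite -[g1](subrK (k1 * l)) -eta_affine//; apply: le_integral => //.
    - apply: (bounded_integrable (k := `|g1 - k1 * l| + `|k1|)) => //.
      by move=> t; exact: affine_bounded.
    - exact: iphi.
    - by move=> t _; rewrite lee_fin le_max lexx.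
  rewrite -[g2](subrK (k2 * (1 - l))) -eta_affine//; apply: le_integral => //.
  - apply: (bounded_integrable (k := `|g2 - k2 * (1 - l)| + `|k2|)) => //.
    by move=> t; exact: affine_bounded.
  - exact: iphi.
  - by move=> t _; rewrite lee_fin le_max lexx orbT.
move=> x; rewrite ip_nabla.
set g0 := ip (F 0 x) x; set g1 := ip (F 1 x) x.
have iphi : (sigma l a).-integrable D (EFin \o (fun t : R => g0 + (g1 - g0) * t)).
  apply: (bounded_integrable (k := `|g0| + `|g1 - g0|)) => //.
  by move=> t; exact: affine_bounded.
have := bochner_ip_le mD bv iphi (x := x).
rewrite (integral_sigma a l01 (measurable_affine _ _) (@affine_bounded _ _)).
(* The mean of [sigma] is [(1 - a) * l + a * (1 - l)], which is [r_weight l a]. *)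
rewrite !eta_affine// -!EFinM -EFinD lee_fin => h.
apply: le_trans (h _) _; last by rewrite /r_weight; lra.
move=> t /D01 t01; have := convex01_chord (op_convex01_ip cF x) t01.
by rewrite -/g0 -/g1; lra.
Qed.

(** [r_weight l] is affine in its second argument and runs from [l] to [1 - l], so it preserves the
    unit interval and convexity. *)
Lemma op_convex01_r_weight F (l : R) : 0 <= l <= 1 -> op_convex01 F ->
  op_convex01 (fun t => F (r_weight l t)).
Proof.
move=> l01 [sF cF].
have r01 t : 0 <= t <= 1 -> 0 <= r_weight l t <= 1.
  move=> t01; have -> : r_weight l t = (1 - t) * l + t * (1 - l).
    by rewrite /r_weight; ring.
  by apply: itv01_convex => //; move: l01 => /andP[? ?]; apply/andP; split; lra.
split=> [t t01|s t k s01 t01 k01]; first by apply: sF; exact: r01.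
have -> : r_weight l ((1 - k) * s + k * t) =
    (1 - k) * r_weight l s + k * r_weight l t by rewrite /r_weight; ring.
by apply: cF => //; exact: r01.
Qed.

Lemma r_weight0 (l : R) : r_weight l 0 = l.
Proof. by rewrite /r_weight; ring. Qed.

Lemma r_weight1 (l : R) : r_weight l 1 = 1 - l.
Proof. by rewrite /r_weight; ring. Qed.

(** The first two bounds are those of [eta] for the reparametrized map, with ends [F l] and
    [F (1 - l)]; the last two are those of [sigma] for [F] itself. *)
Lemma jensen_chain F (l : R) (a : {i01 R}) v w : 0 < l < 1 -> op_convex01 F ->
  is_bochner (eta a%:num) D (fun t => F (r_weight l t)) v ->
  is_bochner (sigma l a) D F w ->
  [/\ F (r_weight l a%:num) <=op v,
      v <=op nabla a%:num (F l) (F (1 - l)),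
      nabla a%:num (F l) (F (1 - l)) <=op w
    & w <=op nabla (r_weight l a%:num) (F 0) (F 1)].
Proof.
move=> l01 cF bv bw.
have l01' : 0 <= l <= 1 by have /andP[? ?] := l01; rewrite !ltW.
have [h1 h2] := eta_hermite_hadamard (i01_itv a) (op_convex01_r_weight l01' cF) bv.
rewrite /= r_weight0 r_weight1 in h2.
by have [h3 h4] := sigma_hermite_hadamard l01 cF bw.
Qed.

Lemma jensen_chain_bochner F (l : R) (a : {i01 R}) : 0 < l < 1 -> op_convex01 F ->
  (exists v, is_bochner (eta a%:num) D (fun t => F (r_weight l t)) v) /\
  (exists w, is_bochner (sigma l a) D F w).
Proof.
move=> l01 cF.
have l01' : 0 <= l <= 1 by have /andP[? ?] := l01; rewrite !ltW.
split; apply: op_convex01_bochner => //.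
- exact/eta_lty/i01_itv.
- exact: op_convex01_r_weight.
- exact: sigma_lty.
Qed.

End jensen_chain.

(** * From convex operator maps to the functional calculus *)

Theorem theorem2p5 (R : realType) (H : hilbertType R) (I : set R)
    (hI : is_interval I) (hI0 : I !=set0)
    (f : R -> R) (hf : {within I, continuous f})
    (l : R) (hl : 0 < l < 1) (a : {i01 R})
    (A B : 'B(H)) (hA : self_adjoint_on I A) (hB : self_adjoint_on I B) :
  (operator_convex H I f ->
    [/\ cfc f (nabla (r_weight l a%:num) A B) <=op
          bochner (eta a%:num) `[0, 1] (fun t => cfc f (nabla (r_weight l t) A B)),
        bochner (eta a%:num) `[0, 1] (fun t => cfc f (nabla (r_weight l t) A B)) <=op
          nabla a%:num (cfc f (nabla l A B)) (cfc f (nabla (1 - l) A B)),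
        nabla a%:num (cfc f (nabla l A B)) (cfc f (nabla (1 - l) A B)) <=op
          Mean l a f A B
      & Mean l a f A B <=op nabla (r_weight l a%:num) (cfc f A) (cfc f B)]) /\
  (operator_concave H I f ->
    [/\ bochner (eta a%:num) `[0, 1] (fun t => cfc f (nabla (r_weight l t) A B)) <=op
          cfc f (nabla (r_weight l a%:num) A B),
        nabla a%:num (cfc f (nabla l A B)) (cfc f (nabla (1 - l) A B)) <=op
          bochner (eta a%:num) `[0, 1] (fun t => cfc f (nabla (r_weight l t) A B)),
        Mean l a f A B <=op
          nabla a%:num (cfc f (nabla l A B)) (cfc f (nabla (1 - l) A B))
      & nabla (r_weight l a%:num) (cfc f A) (cfc f B) <=op Mean l a f A B]).
Proof.
pose F t := cfc f (nabla t A B).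
have F0 : F 0 = cfc f A by rewrite /F nabla0.
have F1 : F 1 = cfc f B by rewrite /F nabla1.
have sF t : self_adjoint (F t) by apply/sa_cfc/sa_nabla; [case: hA|case: hB].
have IF t : 0 <= t <= 1 -> self_adjoint_on I (nabla t A B).
  exact: self_adjoint_on_nabla.
split=> cf.
  have cF : op_convex01 F.
    split=> [t _|s t k s01 t01 k01]; first exact: sF.
    by rewrite /F -nabla_nabla; apply: cf => //; exact: IF.
  have [ev ew] := jensen_chain_bochner a hl cF.
  (* [bochner] is an [xget], so existence of an integral ensures that the chosen value is one. *)
  have := jensen_chain hl cF (xgetPex 0 ev) (xgetPex 0 ew).
  by rewrite F0 F1.
have cF : op_convex01 (\- F).
  split=> [t _|s t k s01 t01 k01]; first exact/saN/sF.
  rewrite /= nablaN; apply: op_leN; rewrite !opprK.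
  by rewrite /F -nabla_nabla; apply: cf => //; exact: IF.
(* Existence is known for the convex map [\- F], whereas the statement integrates [F]: negating
   gives existence for [F], and the chosen integrals of [F] are negated back to enter the chain for
   [\- F]. *)
have [[v /is_bochnerN bv] [w /is_bochnerN bw]] := jensen_chain_bochner a hl cF.
have ev : exists v, is_bochner (eta a%:num) `[0, 1] (fun t => F (r_weight l t)) v.
  exists (- v); congr is_bochner : bv.
  by apply/funext => t /=; rewrite opprK.
have ew : exists w, is_bochner (sigma l a) `[0, 1] F w.
  exists (- w); congr is_bochner : bw.
  by apply/funext => t /=; rewrite opprK.
have [h1 h2 h3 h4] := jensen_chain hl cF (is_bochnerN (xgetPex 0 ev))
  (is_bochnerN (xgetPex 0 ew)).
rewrite !nablaN F0 F1 in h2 h3 h4.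
by split; apply: op_leN.
Qed.
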